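(* Let $p$ be an odd prime and let $a$ be a positive integer. If $p\neq 5$, then $$\sum_{k=0}^{(p^a-1)/2}\frac{\binom{2k}{k}}{(-16)^k}\equiv\left(\frac{p^a}{5}\right)\left(1+\frac{F_{p^a-(\frac{p^a}{5})}}{2}\right)\pmod{p^3}.$$ If $p\neq 3$, then $$\sum_{k=0}^{(p^a-1)/2}\frac{\binom{2k}{k}}{(-32)^k}\equiv\left(\frac{2}{p^a}\right)\left(1+\frac{2^{p^a-1}-1}{6}-\frac{(2^{p^a-1}-1)^2}{8}\right)\pmod{p^3}.$$
   Context: $\{F_n\}_{n\ge0}$ is the Fibonacci sequence: $F_0=0$, $F_1=1$, $F_{n+1}=F_n+F_{n-1}$. $\left(\frac{\cdot}{\cdot}\right)$ denotes the Jacobi symbol. Congruences between rational numbers whose denominators are prime to $p$ are understood in the ring of rationals with denominator prime to $p$ (i.e. $x\equiv y\pmod{p^n}$ means $(x-y)/p^n$ is such a rational). *)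

(* Defs.v *)
From mathcomp Require Export all_boot all_order all_algebra.

Set Implicit Arguments.
Unset Strict Implicit.
Unset Printing Implicit Defensive.

Import GRing.Theory Num.Theory.
Local Open Scope ring_scope.

Fixpoint fib (n : nat) : nat :=
  match n with
  | 0 => 0
  | 1 => 1
  | (m.+1 as m').+1 => fib m' + fib m
  end%N.

(* Legendre symbol, meaningful for q an odd prime. *)
Definition legendre (m : int) (q : nat) : int :=
  if (q%:Z %| m)%Z then 0
  else if [exists x : 'I_q, (x%:Z ^+ 2 == m %[mod q%:Z])%Z] then 1
  else -1.

(* Jacobi symbol (m / n), meaningful for n odd and positive; it is 1 for
   n = 1 (empty product). *)
Definition jacobi (m : int) (n : nat) : int :=
  \prod_(q <- primes n) legendre m q ^+ logn q n.

(* The ring of rationals with denominator prime to p. *)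
Definition pintegral (p : nat) (x : rat) : bool := coprime p `|denq x|.

(* x = y (mod p ^ n) in the ring of rationals with denominator prime to p. *)
Definition ratcong (p n : nat) (x y : rat) : bool :=
  pintegral p ((x - y) / (p ^ n)%:R).

(* Main.v *)
(* Write q = p^a = 2n + 1 and expand
     C(n+k, 2k) (-16)^k = C(2k, k) prod_{j<k} (1 - q^2 / (2j+1)^2).
   Modulo p^3 this gives, for d = -16 or -32 and x = -16/d,
     sum_k C(2k, k) / d^k = U_n(x) + p^2 C,
   where U_n(x) = sum_k C(n+k, 2k) x^k is a Chebyshev-type sum, equal to F_q for
   x = 1 and to (1 + 2^q) / (3 * 2^n) for x = 1/2, and the correction
   C = sum_k C(2k, k) / d^k sum_{j<k} (p^(a-1) / (2j+1))^2 matters modulo p only.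
   Lucas' theorem reduces C to the case a = 1.  There, over a field of
   characteristic p, t x = (t-1)^2 implies
     t^((p-1)/2) (1+t) C = D(t) / 2  with  D(t) = sum_{0<k<p} t^k / k^2,
   and Granville's identity
     L(t)^2 = -2 t^p D(t) - 2 (1 - t^p) D(1-t),  L(t) = sum_{0<k<p} t^k / k,
   evaluates D(2) and D(phi^2), phi the golden ratio, through the quotients
   (2^p - 2) / p and (L_p - 1) / p, L_p the Lucas number. *)

From HB Require Import structures.
Require Import Defs.
From mathcomp Require Import all_field.
From mathcomp Require Import zify ring.

Set Implicit Arguments.
Unset Strict Implicit.
Unset Printing Implicit Defensive.
Import GRing.Theory Num.Theory.
Local Open Scope ring_scope.

(** * Central binomial coefficients and Chebyshev sums *)

(** The leading term [U_n] and the stated value differ at second order by a multiple of a squared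
    quotient, and [p ^ 2 C] cancels exactly that multiple. For the terms to be comparable they must
    be written in one quotient: [C] yields the quotients of [2] and of Lucas numbers at [p], whereas
    [U_n] and the right-hand side live at [q]. The two agree modulo [p] because [2 ^ q = 2 ^ p] and
    [L_q = L_p] modulo [p ^ 2]. The summands of [C] are [p]-integral since [2j+1 < q] has valuation
    at most [a - 1]. Reduction modulo [p] is [ratr] into an algebraically closed field of
    characteristic [p] rather than into the prime field, since the golden ratio and the square root
    of [2] may lie outside the latter; Frobenius acting on them is what produces the symbols [(q/5)]
    and [(2/q)]. The polylogarithm identities rest on [D(1) = 0], which is false for [p = 3], so
    that [d = -16] with [p = 3] is computed by hand. *)

Lemma eq_natr (R : pzSemiRingType) (m n : nat) : m = n -> m%:R = n%:R :> R.
Proof. by move->. Qed.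

Lemma central_bin_rec k :
  (k.+1 * 'C(2 * k.+1, k.+1) = 2 * (2 * k).+1 * 'C(2 * k, k))%N.
Proof.
have h1 := mul_bin_diag (2 * k).+2 k.
have h2 := mul_bin_down (2 * k).+1 k.
rewrite (_ : (2 * k).+1 - k = k.+1)%N /= in h2; last lia.
rewrite (_ : 2 * k.+1 = (2 * k).+2)%N; last lia.
rewrite -h1 /=; nia.
Qed.

(** The difference of the two odd squares is [4 (m+k+1) (m-k)]. The form without division serves
    over [rat] as well as in characteristic [p]. *)
Lemma bin_even_rec (R : comNzRingType) m k :
  4 * (2 * k).+1%:R * (2 * k).+2%:R * 'C(m + k.+1, 2 * k.+1)%:R
  = ((2 * m).+1%:R ^+ 2 - (2 * k).+1%:R ^+ 2) * 'C(m + k, 2 * k)%:R :> R.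
Proof.
have [lt_mk|le_km] := ltnP m k.
  by rewrite !bin_small ?mulr0 //; lia.
have h1 := mul_bin_diag (m + k).+1 (2 * k).+1.
have h2 := mul_bin_left (m + k) (2 * k).
rewrite (_ : m + k - 2 * k = m - k)%N in h2; last lia.
have e : ((2 * k).+1 * (2 * k).+2 * 'C(m + k.+1, 2 * k.+1)
          = (m + k).+1 * (m - k) * 'C(m + k, 2 * k))%N.
  rewrite (_ : m + k.+1 = (m + k).+1)%N; last lia.
  rewrite (_ : 2 * k.+1 = (2 * k).+2)%N; last lia.
  by rewrite -mulnA -h1 /= -[RHS]mulnA -h2; lia.
have := eq_natr R e; rewrite !natrM natrB //.
rewrite -!mulrA => ->; ring.
Qed.

Lemma bin_hockey n k :
  (\sum_(0 <= m < n) 'C(m + k, 2 * k) = 'C(n + k, (2 * k).+1))%N.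
Proof.
elim: n => [|n IH]; first by rewrite big_geq // bin_small //; lia.
by rewrite big_nat_recr //= IH addSn binS.
Qed.

(** One use of [bin_even_rec] and of [central_bin_rec] per factor. Over [rat] it gives the expansion
    in powers of [p]; in characteristic [p = 2n+1] the product is [1]. *)
Lemma bin_central_prod (F : fieldType) n k :
  (forall j, (j < k)%N -> (2 * j).+1%:R != 0 :> F) ->
  (forall j, (j < k)%N -> j.+1%:R != 0 :> F) -> 2 != 0 :> F ->
  'C(n + k, 2 * k)%:R * (-16) ^+ k
  = 'C(2 * k, k)%:R
    * \prod_(0 <= j < k) (1 - (2 * n).+1%:R ^+ 2 / (2 * j).+1%:R ^+ 2) :> F.
Proof.
move=> odd_neq0 neq0 two_neq0.
elim: k odd_neq0 neq0 => [|k IH] odd_neq0 neq0.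
  by rewrite big_geq // !bin0 expr0.
have {}IH := IH (fun j hj => odd_neq0 j (ltnW hj)) (fun j hj => neq0 j (ltnW hj)).
have o := odd_neq0 k (ltnSn k); have z := neq0 k (ltnSn k).
have := bin_even_rec F n k; have := eq_natr F (central_bin_rec k).
rewrite (_ : (2 * k).+2 = 2 * k.+1)%N; last lia.
rewrite !natrM big_nat_recr //= [(-16) ^+ k.+1]exprS.
move: ('C(n + k, _)%:R) ('C(n + k.+1, _)%:R) ('C(2 * k, k)%:R)
  ('C(2 * k.+1, _)%:R) ((2 * k).+1%:R) (k.+1%:R) ((2 * n).+1%:R)
  (\prod_(_ <= j < k) _) ((-16) ^+ k) IH o z.
move=> u u' b b' o1 k1 N pr s IH o z hb hu.
have nz8 : 8 != 0 :> F by rewrite (_ : 8 = 2 ^+ 3) ?expf_neq0 // -natrX.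
have -> : b' = 2 * o1 * b / k1 by apply: (mulfI z); rewrite hb; field.
have -> : u' = (N ^+ 2 - o1 ^+ 2) * u / (8 * o1 * k1).
  apply: (mulfI (mulf_neq0 (mulf_neq0 nz8 o) z)).
  rewrite [RHS]mulrC divfK ?mulf_neq0 // -hu; ring.
transitivity ((N ^+ 2 - o1 ^+ 2) / (8 * o1 * k1) * (-16) * (u * s));
  first by ring.
rewrite IH; field; rewrite z o nz8 //.
Qed.

Section ChebyshevSums.
Variable R : comNzRingType.
Implicit Types (m : nat) (x t : R).

(** These are the Morgan-Voyce polynomials [b_m] and [B_(m-1)]. Pascal's rule links each to the
    other, so they are always treated as a pair. *)
Definition chebU m x := \sum_(0 <= k < m.+1) 'C(m + k, 2 * k)%:R * x ^+ k.
Definition chebW m x := \sum_(0 <= k < m) 'C(m + k, (2 * k).+1)%:R * x ^+ k.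

Lemma chebW_rec m x : chebW m.+1 x = chebW m x + chebU m x.
Proof.
rewrite /chebW /chebU.
under eq_bigr => k _ do rewrite addSn binS natrD mulrDl.
rewrite big_split /=; congr (_ + _).
by rewrite big_nat_recr //= bin_small ?mul0r ?addr0 //; lia.
Qed.

Lemma chebU_rec m x : chebU m.+1 x = chebU m x + x * chebW m.+1 x.
Proof.
rewrite /chebW /chebU big_nat_recl // !muln0 !bin0 expr0 mulr1.
rewrite (_ : \sum_(0 <= k < m.+1) 'C(m.+1 + k.+1, 2 * k.+1)%:R * x ^+ k.+1 =
  \sum_(0 <= k < m.+1) 'C(m + k.+1, 2 * k.+1)%:R * x ^+ k.+1 + 
  x * \sum_(0 <= k < m.+1) 'C(m.+1 + k, (2 * k).+1)%:R * x ^+ k); last first.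
  rewrite big_distrr -big_split /=; apply: eq_bigr => k _.
  rewrite addSn (_ : 2 * k.+1 = (2 * k).+2)%N; last lia.
  rewrite binS natrD exprS addSnnS; ring.
rewrite addrA; congr (_ + _).
rewrite [in RHS]big_nat_recl // muln0 bin0 expr0 mulr1; congr (_ + _).
by rewrite big_nat_recr //= bin_small ?mul0r ?addr0 //; lia.
Qed.

Lemma chebUE m x t : t * x = (t - 1) ^+ 2 ->
  t ^+ m * (1 + t) * chebU m x = 1 + t ^+ (2 * m).+1.
Proof.
move=> tx.
(* The companion formula for [chebW] carries a factor [t - 1], matching [t * x = (t - 1) ^+ 2] in
   the recurrence, so that the induction never divides. *)
suff [] : t ^+ m * (1 + t) * chebU m x = 1 + t ^+ (2 * m).+1 /\
  (t - 1) * (t ^+ m * (1 + t) * chebW m x) = t * (t ^+ (2 * m) - 1) by [].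
elim: m => [|m [IHU IHW]].
  by rewrite /chebU /chebW big_nat1 big_geq //= !expr0 bin0; split; ring.
have eW : (t - 1) * (t ^+ m.+1 * (1 + t) * chebW m.+1 x) = t * (t ^+ (2 * m.+1)
  - 1).
  rewrite chebW_rec exprS.
  transitivity (t * ((t - 1) * (t ^+ m * (1 + t) * chebW m x) + (t - 1) *(t ^+
    m * (1 + t) * chebU m x))); first by ring.
  rewrite IHU IHW (_ : 2 * m.+1 = (2 * m).+2)%N; last lia.
  by rewrite !exprS; ring.
split=> //; rewrite chebU_rec.
transitivity (t * (t ^+ m * (1 + t) * chebU m x) + (t * x) * (t ^+ m * (1 + t)
  * chebW m.+1 x)).
  by rewrite exprS; ring.
rewrite IHU tx chebW_rec.
transitivity (t * (1 + t ^+ (2 * m).+1) + (t - 1) * ((t - 1) * (t ^+ m * (1 +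
  t) * chebW m x) + (t - 1) *(t ^+ m * (1 + t) * chebU m x))); first by ring.
rewrite IHU IHW (_ : 2 * m.+1 = (2 * m).+2)%N; last lia.
by rewrite !exprS; ring.
Qed.

Lemma chebU1 m : chebU m 1 = (fib (2 * m).+1)%:R.
Proof.
suff [] : chebU m 1 = (fib (2 * m).+1)%:R /\ chebW m 1 = (fib (2 * m))%:R by [].
elim: m => [|m [IHU IHW]].
  by rewrite /chebU /chebW big_nat1 big_geq //= expr0 bin0 mulr1.
rewrite chebU_rec chebW_rec IHU IHW mul1r -!natrD.
rewrite (_ : 2 * m.+1 = (2 * m).+2)%N; last lia.
by split; congr _%:R; rewrite /=; lia.
Qed.

End ChebyshevSums.

(** * Finite polylogarithms in characteristic p *)

Lemma sum_even_odd (V : zmodType) n (f : nat -> V) :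
  \sum_(0 <= k < (2 * n).+1) f k
  = \sum_(0 <= i < n.+1) f (2 * i)%N + \sum_(0 <= i < n) f (2 * i).+1.
Proof.
elim: n => [|n IH]; first by rewrite big_nat1 [X in _ + X]big_geq // big_nat1
  addr0.
rewrite (_ : (2 * n.+1).+1 = (2 * n).+3)%N; last lia.
rewrite big_nat_recr //= big_nat_recr //= IH.
rewrite [\sum_(0 <= i < n.+2) _]big_nat_recr //=.
rewrite [\sum_(0 <= i < n.+1) f _.+1]big_nat_recr //=.
rewrite (_ : 2 * n.+1 = (2 * n).+2)%N; last lia.
by rewrite -!addrA; congr (_ + _); rewrite addrA addrC.
Qed.

Lemma pchar_pnat_expn (R : nzSemiRingType) p e :
  p \in [pchar R] -> [pchar R].-nat (p ^ e)%N.
Proof. by move=> cp; rewrite pnatX pnatE ?cp // (pcharf_prime cp). Qed.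

Section FinitePolylog.
Variables (K : fieldType) (p n : nat).
Hypotheses (pE : p = (2 * n).+1) (charK : p \in [pchar K]).

Let natr_neq0 k : (0 < k < p)%N -> k%:R != 0 :> K.
Proof. by move=> hk; rewrite -(dvdn_pcharf charK) gtnNdvd; lia. Qed.

Let p_gt2 : (2 < p)%N.
Proof. by have := prime_gt1 (pcharf_prime charK); lia. Qed.

Let natrp : p%:R = 0 :> K.
Proof. exact: pcharf0. Qed.

Let two_neq0 : 2 != 0 :> K.
Proof. by apply: natr_neq0; lia. Qed.

Let four_neq0 : 4 != 0 :> K.
Proof. by rewrite (natrM K 2 2) mulf_neq0. Qed.

(** For [s > 0] the term [k = 0] vanishes because [0^-1 = 0]; starting there makes the split into
    even and odd exponents uniform. *)
Definition fpolylog s (x : K) := \sum_(0 <= k < p) x ^+ k / k%:R ^+ s.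

Lemma fpolylogE s x : (0 < s)%N ->
  fpolylog s x = \sum_(1 <= k < p) x ^+ k / k%:R ^+ s.
Proof.
move=> s_gt0; rewrite /fpolylog big_ltn; last lia.
by rewrite expr0n gtn_eqF // invr0 mulr0 add0r.
Qed.

(** Substitute [p - k] for [k], which is [- k] in [K]. *)
Lemma fpolylog_inv s x : (0 < s)%N -> x != 0 ->
  x ^+ p * fpolylog s x^-1 = (-1) ^+ s * fpolylog s x.
Proof.
move=> s_gt0 x0; rewrite !fpolylogE // big_nat_rev /= !big_distrr /=.
apply: eq_big_nat => k hk.
rewrite (_ : 1 + p - k.+1 = p - k)%N; last lia.
rewrite natrB ?natrp ?sub0r; last lia.
have -> : ((- k%:R) ^+ s)^-1 = (-1) ^+ s / k%:R ^+ s :> K.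
  by rewrite [in LHS]exprNn invfM -signr_odd invr_sign.
rewrite mulrA [X in X * _ = _](_ : _ = x ^+ k); first by rewrite mulrCA.
rewrite exprVn -{1}(subnKC (_ : k <= p)%N); last lia.
by rewrite exprD mulfK // expf_neq0.
Qed.

(** Distribution relation: doubling the index sends [k <= n] to even numbers below [p], and [k > n]
    to [p] plus an odd number, which equals that odd number in [K]. The right-hand side separates
    the even and odd parts of [fpolylog 2 x]. *)
Lemma fpolylog2_sqr x :
  fpolylog 2 (x ^+ 2)
  = 2 * (1 + x ^+ p) * fpolylog 2 x + 2 * (1 - x ^+ p) * fpolylog 2 (- x).
Proof.
rewrite /fpolylog (big_cat_nat (n := n.+1)) //=; last lia.
rewrite {3 5}pE !sum_even_odd.
pose E := \sum_(0 <= i < n.+1) x ^+ (2 * i) / (2 * i)%:R ^+ 2.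
pose O := \sum_(0 <= i < n) x ^+ (2 * i).+1 / (2 * i).+1%:R ^+ 2.
have -> : \sum_(0 <= i < n.+1) (- x) ^+ (2 * i) / (2 * i)%:R ^+ 2 = E.
  by apply: eq_bigr => i _; rewrite [in LHS]exprM sqrrN -exprM.
have -> : \sum_(0 <= i < n) (- x) ^+ (2 * i).+1 / (2 * i).+1%:R ^+ 2 = - O.
  rewrite /O -sumrN; apply: eq_bigr => i _.
  by rewrite [in LHS]exprS exprM sqrrN -exprM mulNr -exprS mulNr.
rewrite -/E -/O.
have -> : \sum_(0 <= i < n.+1) (x ^+ 2) ^+ i / i%:R ^+ 2 = 4 * E.
  rewrite /E big_distrr; apply: eq_big_nat => /= i hi.
  rewrite -exprM natrM exprMn.
  have [->|i0] := eqVneq i 0%N; first by rewrite expr0n /= !(mulr0, invr0).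
  by field; rewrite four_neq0 natr_neq0; lia.
have -> : \sum_(n.+1 <= i < p) (x ^+ 2) ^+ i / i%:R ^+ 2 = 4 * x ^+ p * O.
  rewrite -[n.+1]add0n big_addn (_ : p - n.+1 = n)%N; last lia.
  rewrite /O big_distrr; apply: eq_big_nat => /= i hi.
  rewrite -exprM (_ : 2 * (i + n.+1) = p + (2 * i).+1)%N; last lia.
  have -> : (2 * i).+1%:R = 2 * (i + n.+1)%:R :> K.
    rewrite -natrM (_ : 2 * (i + n.+1) = p + (2 * i).+1)%N; last lia.
    by rewrite natrD natrp add0r.
  have : (i + n.+1)%:R != 0 :> K by apply: natr_neq0; lia.
  by move: (i + n.+1)%:R => c c0; rewrite exprD; field; rewrite c0 two_neq0.
by ring.
Qed.

(** The distribution relation at [1] reads [D(1) = 4 D(1)], and [3] is invertible. *)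
Lemma fpolylog2_1 : (3 < p)%N -> fpolylog 2 1 = 0.
Proof.
move=> p_gt3; have := fpolylog2_sqr 1; rewrite !expr1n => e.
have nz3 : 3 != 0 :> K by apply: natr_neq0; lia.
apply: (mulfI nz3); rewrite mulr0.
transitivity (2 * (1 + 1) * fpolylog 2 1 + 2 * (1 - 1) * fpolylog 2 (-1) -
  fpolylog 2 1); first by ring.
by rewrite -e subrr.
Qed.

(** The exponents [n - m] and [n + m + 1] exhaust [1, ..., p - 1], and twice either of them is
    [2m+1] up to sign in [K]. *)
Lemma fpolylog2_fold t :
  \sum_(0 <= m < n) (t ^+ (n - m) + t ^+ (n + m.+1)) / (2 * m).+1%:R ^+ 2
  = fpolylog 2 t / 4.
Proof.
rewrite fpolylogE // [in RHS](big_cat_nat (n := n.+1)) //=; last lia.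
under eq_bigr => m _ do rewrite mulrDl.
rewrite big_split mulrDl; congr (_ + _).
  rewrite big_add1 /= big_nat_rev /= add0n big_distrl;
    apply: eq_big_nat => /= i hi.
  rewrite (_ : n - (n - i.+1) = i.+1)%N; last lia.
  have -> : (2 * (n - i.+1)).+1%:R = - (2 * i.+1%:R) :> K.
    apply/eqP; rewrite -addr_eq0 -natrM -natrD.
    by rewrite (_ : _ + _ = p)%N ?natrp //; lia.
  have : i.+1%:R != 0 :> K by apply: natr_neq0; lia.
  by move: i.+1%:R => c c0; field; rewrite four_neq0 c0 oppr_eq0 mulf_neq0.
rewrite -[n.+1]add0n big_addn (_ : p - n.+1 = n)%N; last lia.
rewrite big_distrl; apply: eq_big_nat => /= i hi.
rewrite (_ : n + i.+1 = i + n.+1)%N; last lia.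
have -> : (2 * i).+1%:R = 2 * (i + n.+1)%:R :> K.
  rewrite -natrM (_ : 2 * (i + n.+1) = p + (2 * i).+1)%N; last lia.
  by rewrite natrD natrp add0r.
have : (i + n.+1)%:R != 0 :> K by apply: natr_neq0; lia.
by move: (i + n.+1)%:R => c c0; field; rewrite c0 ?two_neq0 ?four_neq0.
Qed.

Definition odd_harm2 k : K := \sum_(0 <= j < k) ((2 * j).+1%:R ^+ 2)^-1.

Lemma bin_half_central k : (k <= n)%N ->
  'C(n + k, 2 * k)%:R = 'C(2 * k, k)%:R / (-16) ^+ k :> K.
Proof.
move=> le_kn.
have nz : (-16) ^+ k != 0 :> K.
  by rewrite expf_neq0 // oppr_eq0 (natrM K 4 4) mulf_neq0.
apply: (canRL (mulfK nz)); rewrite bin_central_prod => // [|j hj|j hj].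
- by rewrite -pE natrp big1 ?mulr1 // => j _; rewrite expr0n /= mul0r subr0.
- by apply: natr_neq0; lia.
- by apply: natr_neq0; lia.
Qed.

(** Turns the product of a coefficient and a harmonic sum into a linear combination of coefficients
    of Chebyshev sums. In the induction, [bin_even_rec] divided by [(2m+1) ^ 2] splits as
    [1 - (2k+1) ^ 2 / (2m+1) ^ 2]: the first part is summed by [bin_hockey], the second is the
    previous case. The base case is [D(1) = 0]. *)
Lemma bin_odd_harm2 k : (3 < p)%N -> (k <= n)%N ->
  'C(2 * k, k)%:R / (-16) ^+ k * odd_harm2 k
  = 2 * \sum_(0 <= m < n) 'C(m + k, 2 * k)%:R / (2 * m).+1%:R ^+ 2.
Proof.
move=> p_gt3; elim: k => [_|k IH lt_kn].
  rewrite /odd_harm2 big_geq // mulr0 (_ : \sum_(_ <= m < _) _ = 0) ?mulr0 //.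
  have := fpolylog2_fold 1; rewrite fpolylog2_1 // mul0r.
  under eq_bigr => m _ do rewrite !expr1n.
  rewrite -big_distrr /= => /eqP; rewrite mulf_eq0 (negPf two_neq0) /= => /eqP e.
  rewrite -[RHS]e; apply: eq_bigr => m _.
  by rewrite addn0 muln0 bin0 mul1r.
rewrite /odd_harm2 big_nat_recr //= -/(odd_harm2 k).
have {}IH := IH (ltnW lt_kn).
have o : (2 * k).+1%:R != 0 :> K by apply: natr_neq0; lia.
have z : k.+1%:R != 0 :> K by apply: natr_neq0; lia.
(* Uses [2 (n - k) = p - (2k+1)], that is [- (2k+1)] in [K]. *)
have hockey : 'C(n + k, (2 * k).+1)%:R * 2 = - 'C(n + k, 2 * k)%:R :> K.
  have := eq_natr K (mul_bin_left (n + k) (2 * k)).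
  rewrite !natrM => e; apply: (mulfI o); rewrite mulrA e.
  have : (n + k - 2 * k)%:R * 2 = - (2 * k).+1%:R :> K.
    apply/eqP; rewrite -addr_eq0 -natrM -natrD.
    by rewrite (_ : _ + _ = p)%N ?natrp //; lia.
  by rewrite mulrAC => ->; rewrite mulNr mulrN.
have nz8 : 8 != 0 :> K by rewrite (natrM K 4 2) mulf_neq0.
have e : \sum_(0 <= m < n) 'C(m + k.+1, 2 * k.+1)%:R / (2 * m).+1%:R ^+ 2 =
  ('C(n + k, (2 * k).+1)%:R - (2 * k).+1%:R ^+ 2
    * \sum_(0 <= m < n) 'C(m + k, 2 * k)%:R / (2 * m).+1%:R ^+ 2)
    / (8 * (2 * k).+1%:R * k.+1%:R) :> K.
  rewrite -bin_hockey natr_sum big_distrr -sumrB big_distrl /=.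
  apply: eq_big_nat => m hm.
  have om : (2 * m).+1%:R != 0 :> K by apply: natr_neq0; lia.
  have := bin_even_rec K m k; rewrite (_ : (2 * k).+2 = 2 * k.+1)%N; last lia.
  rewrite natrM; move: ('C(m + k.+1, _)%:R) ('C(m + k, _)%:R) om o z.
  move: ((2 * m).+1%:R) ((2 * k).+1%:R) (k.+1%:R) => M o1 k1 u' u M0 o0 k0 hu.
  have -> : u' = (M ^+ 2 - o1 ^+ 2) * u / (8 * o1 * k1).
    apply: (mulfI (mulf_neq0 (mulf_neq0 nz8 o0) k0)).
    by rewrite [RHS]mulrC divfK ?mulf_neq0 // -hu; ring.
  by field; rewrite M0 o0 k0 nz8.
rewrite {}e mulrA; apply: (canRL (mulfK _)); first by rewrite !mulf_neq0.
rewrite mulrBr [2 * 'C(_, _)%:R]mulrC hockey bin_half_central ?(ltnW lt_kn) //.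
rewrite [2 * (_ * _)]mulrCA -IH [(-16) ^+ k.+1]exprS.
have := eq_natr K (central_bin_rec k); rewrite !natrM.
have : (-16) ^+ k != 0 :> K.
  by rewrite expf_neq0 // oppr_eq0 (natrM K 4 4) mulf_neq0.
move: ((-16) ^+ k) ((2 * k).+1%:R) (k.+1%:R) o z => s o1 k1 o0 k0 s0.
move: ('C(2 * k.+1, k.+1)%:R) ('C(2 * k, k)%:R) (odd_harm2 k) => b' b h hb.
have -> : b' = 2 * o1 * b / k1 by apply: (mulfI k0); rewrite hb; field.
by field; rewrite s0 o0 k0 oppr_eq0 (natrM K 4 4) mulf_neq0.
Qed.

(* Substituting the expansion of [bin_odd_harm2] and exchanging the sums leaves
   Chebyshev sums, which collapse to two powers of [t] each. *)
Lemma central_sum_odd_harm2 (x t : K) : (3 < p)%N -> t * x = (t - 1) ^+ 2 ->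
  t ^+ n * (1 + t)
  * \sum_(0 <= k < n.+1) 'C(2 * k, k)%:R / (-16) ^+ k * x ^+ k * odd_harm2 k
  = fpolylog 2 t / 2.
Proof.
move=> p_gt3 tx.
have -> : \sum_(0 <= k < n.+1)
    'C(2 * k, k)%:R / (-16) ^+ k * x ^+ k * odd_harm2 k
  = 2 * \sum_(0 <= m < n) chebU m x / (2 * m).+1%:R ^+ 2.
  transitivity (\sum_(0 <= k < n.+1) \sum_(0 <= m < n)
    2 * ('C(m + k, 2 * k)%:R * x ^+ k / (2 * m).+1%:R ^+ 2)).
    apply: eq_big_nat => k hk.
    rewrite mulrAC bin_odd_harm2 // -big_distrr /= -mulrA; congr (_ * _).
    by rewrite big_distrl /=; apply: eq_bigr => m _; rewrite mulrAC.
  rewrite exchange_big big_distrr; apply: eq_big_nat => /= m hm.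
  rewrite /chebU -big_distrr /= -big_distrl /=; congr (_ * (_ * _)).
  rewrite (big_cat_nat (n := m.+1)) //=; last lia.
  rewrite [X in _ + X]big_nat [X in _ + X]big1 ?addr0 // => k hk.
  by rewrite bin_small ?mul0r //; lia.
rewrite mulrCA big_distrr /=.
rewrite (_ : \sum_(0 <= m < n) _ = fpolylog 2 t / 4); first by field;
  rewrite two_neq0 four_neq0.
rewrite -fpolylog2_fold; apply: eq_big_nat => m hm; rewrite mulrA.
congr (_ / _); rewrite -(subnK (_ : m <= n)%N); last lia.
rewrite exprD -!mulrA [_ ^+ m * _]mulrA chebUE // mulrDr mulr1 -exprD.
by congr (_ ^+ _ + _ ^+ _); lia.
Qed.

(** * Differential identities between finite polylogarithms *)

Definition polylogX s : {poly K} := \sum_(0 <= k < p) (k%:R ^+ s)^-1 *: 'X^k.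

Lemma horner_polylogX s x : (polylogX s).[x] = fpolylog s x.
Proof.
rewrite /polylogX horner_sum; apply: eq_bigr => k _.
by rewrite hornerZ hornerXn mulrC.
Qed.

Lemma size_polylogX s : (size (polylogX s) <= p)%N.
Proof.
rewrite /polylogX; apply: (leq_trans (size_sum _ _ _)).
rewrite big_mkord; apply/bigmax_leqP => k _.
by rewrite (leq_trans (size_scale_leq _ _)) // size_polyXn.
Qed.

Lemma mulX_deriv_polylogX s : (0 < s)%N ->
  'X * (polylogX s.+1)^`() = polylogX s.
Proof.
move=> s_gt0; rewrite /polylogX raddf_sum /= big_distrr /=;
  apply: eq_big_nat => k hk.
rewrite derivZ derivXn -scalerAr mulrnAr -exprS.
case: k hk => [|k] hk /=; first by rewrite !expr0n /= gtn_eqF // invr0 !scale0r.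
have z : k.+1%:R != 0 :> K by apply: natr_neq0; lia.
by rewrite -scaler_nat scalerA exprS invfM mulrAC mulVf // mul1r.
Qed.

Lemma mul1X_deriv_polylogX : (1 - 'X) * (polylogX 1)^`() = 1 - 'X^(p.-1).
Proof.
have -> : (polylogX 1)^`() = \sum_(0 <= k < p.-1) 'X^k.
  rewrite /polylogX raddf_sum /= big_ltn; last lia.
  rewrite expr1 invr0 scale0r deriv0 add0r big_add1 big_nat [RHS]big_nat.
  apply: eq_bigr => k hk; rewrite derivZ derivXn expr1 -scaler_nat scalerA.
  by rewrite mulVf ?scale1r //; apply: natr_neq0; lia.
by rewrite big_mkord -opprB mulNr -subrX1 opprB.
Qed.

(** A vanishing derivative leaves only exponents divisible by [p], here [0] and [p]; the values at
    [0] and [1] kill the two coefficients. *)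
Lemma deriv_eq0_poly0 (f : {poly K}) :
  f^`() = 0 -> (size f <= 2 * p)%N -> f.[0] = 0 -> f.[1] = 0 -> f = 0.
Proof.
move=> df sf f0 f1.
have fE : f = f`_p *: 'X^p.
  apply/polyP => i; rewrite coefZ coefXn.
  have [->|ip] := eqVneq i p; first by rewrite mulr1.
  rewrite mulr0; case: i ip => [|i] ip; first by rewrite -horner_coef0.
  have [si|si] := leqP (size f) i.+1; first by rewrite nth_default.
  have := congr1 (fun g : {poly K} => g`_i) df.
  rewrite coef_deriv coef0 -mulr_natr => /eqP; rewrite mulf_eq0 => /orP[/eqP//|].
  rewrite -(dvdn_pcharf charK) => /dvdnP [c ce].
  by case: c ce => [|[|c]] ce; nia.
by move: f1; rewrite fE hornerZ hornerXn expr1n mulr1 => ->; rewrite scale0r.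
Qed.

Lemma exprB_pchar_poly (f g : {poly K}) : (f - g) ^+ p = f ^+ p - g ^+ p.
Proof.
have cp : [pchar {poly K}].-nat p.
  by rewrite -[p]expn1 pchar_pnat_expn // pchar_poly.
by rewrite exprDn_pchar // exprNn_pchar.
Qed.

Let deriv1X : (1 - 'X : {poly K})^`() = -1.
Proof. by rewrite derivB derivX -polyC1 derivC sub0r. Qed.

Let size1X : size (1 - 'X : {poly K}) = 2.
Proof. by rewrite -opprB size_polyN -polyC1 size_XsubC. Qed.

Let comp1X : (1 - 'X : {poly K}) \Po (1 - 'X) = 'X.
Proof. by rewrite comp_polyB comp_polyX -polyC1 comp_polyC opprB addrC subrK. Qed.

Lemma fpolylog0 s : (0 < s)%N -> fpolylog s 0 = 0.
Proof.
move=> s_gt0; rewrite fpolylogE // big_nat big1 // => k hk.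
by rewrite expr0n gtn_eqF ?mul0r //; lia.
Qed.

Lemma fpolylog1_1 : fpolylog 1 1 = 0.
Proof.
have := fpolylog_inv (isT : 0 < 1)%N (oner_neq0 K).
rewrite invr1 expr1n mul1r expr1 mulN1r => e.
by apply: (mulfI two_neq0); rewrite mulr0 mulr_natl mulr2n {1}e addNr.
Qed.

(** [L(x)] is the reduction of [(1 - x ^ p - (1 - x) ^ p) / p], visibly symmetric. Within
    characteristic [p] the argument is by derivatives: after multiplication by [X (1 - X)] their
    equality is [(1 - X) ^ p = 1 - X ^ p]. *)
Lemma polylogX1_sym : polylogX 1 \Po (1 - 'X) = polylogX 1.
Proof.
apply/eqP; rewrite -subr_eq0; apply/eqP; apply: deriv_eq0_poly0.
- have nzX : 'X * (1 - 'X) != 0 :> {poly K}.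
    by rewrite mulf_neq0 ?polyX_eq0 // -size_poly_gt0 size1X.
  apply: (mulfI nzX); rewrite mulr0 derivB deriv_comp deriv1X.
  transitivity (- ((1 - 'X) * ((1 - 'X \Po (1 - 'X)) * ((polylogX 1)^`() \Po (1
    - 'X))) + 'X * ((1 - 'X) * (polylogX 1)^`())) : {poly K}).
    by rewrite comp1X; ring.
  rewrite -comp_polyM mul1X_deriv_polylogX comp_polyB comp_Xn_poly -polyC1
    comp_polyC polyC1.
  transitivity ((1 - 'X) ^+ p.-1.+1 + 'X^(p.-1.+1) - 1 : {poly K}).
    by rewrite !exprS; ring.
  rewrite prednK; last lia.
  by rewrite exprB_pchar_poly expr1n; ring.
- apply: (leq_trans (size_polyD _ _)); rewrite size_polyN.
  rewrite size_comp_poly2 // maxnn (leq_trans (size_polylogX _)) //; lia.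
- rewrite hornerD hornerN horner_comp !horner_polylogX !hornerE.
  by rewrite subr0 fpolylog1_1 fpolylog0 // subr0.
- rewrite hornerD hornerN horner_comp !horner_polylogX !hornerE.
  by rewrite subrr fpolylog1_1 fpolylog0 // subr0.
Qed.

Lemma fpolylog1_sym x : fpolylog 1 (1 - x) = fpolylog 1 x.
Proof.
by rewrite -!horner_polylogX -[in RHS]polylogX1_sym horner_comp !hornerE.
Qed.

(* Granville's identity: both sides have the same derivative, and in degree
   below [2 * p] that determines a polynomial up to [a + b *: 'X^p]. *)
Lemma fpolylog1_sqr x : (3 < p)%N ->
  fpolylog 1 x ^+ 2
  = - (2 * x ^+ p * fpolylog 2 x) - 2 * (1 - x ^+ p) * fpolylog 2 (1 - x).
Proof.
move=> p_gt3.
pose f : {poly K} := polylogX 1 ^+ 2 + 2 * 'X^p * polylogX 2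
   + 2 * (1 - 'X^p) * (polylogX 2 \Po (1 - 'X)).
have dXp : ('X^p)^`() = 0 :> {poly K}.
  by rewrite derivXn -mulr_natr -polyC_natr natrp mulr0.
have fE y : f.[y] = fpolylog 1 y ^+ 2 + 2 * y ^+ p * fpolylog 2 y
   + 2 * (1 - y ^+ p) * fpolylog 2 (1 - y).
  by rewrite /f !(hornerE, horner_comp, horner_polylogX).
suff f0 : f = 0.
  by have := fE x; rewrite f0 horner0 => /eqP; rewrite eq_sym => /eqP e;
    rewrite -[LHS]subr0 -e; ring.
apply: deriv_eq0_poly0.
- have nzX : 'X * (1 - 'X) != 0 :> {poly K}.
    by rewrite mulf_neq0 ?polyX_eq0 // -size_poly_gt0 size1X.
  apply: (mulfI nzX); rewrite mulr0.
  have e1 := mulX_deriv_polylogX (isT : 0 < 1)%N.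
  have e2 := congr1 (comp_poly (1 - 'X)) e1.
  rewrite /= comp_polyM comp_polyX polylogX1_sym in e2.
  have e3 := mul1X_deriv_polylogX.
  have d2 : (2 : {poly K})^`() = 0 by rewrite -polyC_natr derivC.
  have d1 : (1 : {poly K})^`() = 0 by rewrite -polyC1 derivC.
  rewrite /f !derivD expr2 !derivM !derivB deriv_comp deriv1X dXp d1 d2.
  have eX : 'X^p = 'X * 'X^(p.-1) :> {poly K} by rewrite -exprS prednK //; lia.
  transitivity (2 * 'X * polylogX 1 * ((1 - 'X) * (polylogX 1)^`())
    + 2 * 'X^p * (1 - 'X) * ('X * (polylogX 2)^`())
    - 2 * 'X * (1 - 'X^p) * ((1 - 'X) * ((polylogX 2)^`() \Po (1 - 'X))));
      first by ring.
  by rewrite e1 e2 e3 eX; ring.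
- have sM (g h : {poly K}) a b : (size g <= a.+1 -> size h <= b.+1 ->
      size (g * h)%R <= (a + b).+1)%N.
    by move=> sg sh; apply: (leq_trans (size_polyMleq _ _)); lia.
  have s2 : (size (2%:R : {poly K}) <= 1)%N by
    rewrite -polyC_natr size_polyC_leq1.
  have sX : (size ('X^p : {poly K}) <= p.+1)%N by rewrite size_polyXn.
  have s1 : (size ((1 - 'X^p)%R : {poly K}) <= p.+1)%N.
    apply: (leq_trans (size_polyD _ _));
      rewrite size_polyN size_polyXn size_poly1.
    by rewrite geq_max leqnn.
  have sP s : (size (polylogX s) <= (2 * n).+1)%N by rewrite -pE size_polylogX.
  have sC : (size (polylogX 2 \Po (1 - 'X)) <= (2 * n).+1)%N.
    by rewrite size_comp_poly2.
  rewrite /f; apply: (leq_trans (size_polyD _ _)); rewrite geq_max.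
  apply/andP; split; last by apply: leq_trans (sM _ _ _ _ (sM _ _ _ _ s2 s1)
    sC) _; lia.
  apply: (leq_trans (size_polyD _ _)); rewrite geq_max expr2; apply/andP; split.
    by apply: leq_trans (sM _ _ _ _ (sP 1) (sP 1)) _; lia.
  by apply: leq_trans (sM _ _ _ _ (sM _ _ _ _ s2 sX) (sP 2)) _; lia.
(* Both boundary values involve [D(1)]; this is where [p > 3] enters. *)
- rewrite fE expr0n gtn_eqF; last lia.
  by rewrite subr0 fpolylog2_1 // !fpolylog0 // !(mulr0, addr0) expr0n.
- by rewrite fE expr1n subrr fpolylog1_1 fpolylog2_1 // expr0n /= !(mulr0,
  mul0r, addr0).
Qed.

(** Granville's identity at [2], where [2 ^ p = 2] and the second term is a multiple of [D(-1)];
    inversion at [-1] gives [D(-1) = - D(-1)]. *)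
Lemma fpolylog_2 : (3 < p)%N -> 4 * fpolylog 2 2 = - fpolylog 1 2 ^+ 2.
Proof.
move=> p_gt3; rewrite fpolylog1_sqr //.
have -> : 2 ^+ p = 2 :> K.
  by rewrite -(pFrobenius_autE charK) pFrobenius_aut_nat.
have -> : 1 - 2 = -1 :> K by ring.
have := fpolylog_inv (isT : 0 < 2)%N (_ : -1 != 0 :> K).
rewrite oppr_eq0 oner_eq0 => /(_ isT).
have oddp : (-1) ^+ p = -1 :> K by rewrite -signr_odd pE /= oddM.
rewrite invrN invr1 oddp sqrrN expr1n mul1r => e.
have -> : fpolylog 2 (-1) = 0.
  by apply: (mulfI two_neq0); rewrite mulr0 mulr_natl mulr2n -{1}e mulN1r addNr.
by ring.
Qed.

(** Since [1 - phi = - 1 / phi] and [1 + phi = phi ^ 2], the arguments [phi], [- phi], [1 - phi],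
    [phi ^ 2] are closed under the available relations. Granville's identity at [phi] and [- phi],
    inversion at [- phi] and the distribution relation at [phi] form a linear system that determines
    [D(phi ^ 2)]. *)
Lemma fpolylog2_golden (phi : K) : (3 < p)%N -> phi ^+ 2 = phi + 1 ->
  5 * fpolylog 2 (phi ^+ 2) = - (phi ^+ p + 2) * fpolylog 1 phi ^+ 2.
Proof.
move=> p_gt3 phi2.
have phi0 : phi != 0.
  apply/eqP => e; move: phi2; rewrite e expr0n add0r /= => /eqP.
  by rewrite eq_sym oner_eq0.
have u2 : (phi ^+ p) ^+ 2 = phi ^+ p + 1.
  have cp : [pchar K].-nat p by rewrite -[p]expn1 pchar_pnat_expn.
  by rewrite exprAC phi2 exprDn_pchar // expr1n.
have oddp : (-1) ^+ p = -1 :> K by rewrite -signr_odd pE /= oddM.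
have psi : (- phi)^-1 = 1 - phi.
  apply: (mulfI (_ : - phi != 0)); first by rewrite oppr_eq0.
  rewrite divff ?oppr_eq0 //.
  by transitivity (phi ^+ 2 - phi); [rewrite phi2|]; ring.
have nphi0 : - phi != 0 by rewrite oppr_eq0.
have i1 := fpolylog_inv (isT : 0 < 1)%N nphi0.
have i2 := fpolylog_inv (isT : 0 < 2)%N nphi0.
rewrite psi [(- phi) ^+ p]exprNn oddp in i1 i2.
rewrite fpolylog1_sym in i1.
have g1 := fpolylog1_sqr (- phi) p_gt3.
have g2 := fpolylog1_sqr phi p_gt3.
rewrite [(- phi) ^+ p]exprNn oddp opprK [1 + phi]addrC -phi2 in g1.
have s := fpolylog2_sqr phi.
move: (fpolylog 2 (phi ^+ 2)) (fpolylog 2 (1 - phi)) (fpolylog 2 phi)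
  (fpolylog 2 (- phi)) (fpolylog 1 phi) (fpolylog 1 (- phi)) (phi ^+ p) u2
  i1 i2 g1 g2 s => b d' d a l l' u u2 i1 i2 g1 g2 s.
have u0 : u ^+ 2 != 0.
  apply/eqP => e; move: u2; rewrite e => /eqP.
  rewrite eq_sym addr_eq0 => /eqP u1; move: e; rewrite u1 sqrrN expr1n.
  by apply/eqP/oner_neq0.
have l'E : l' = u * l by apply: oppr_inj; rewrite -mulN1r -[-1]expr1 -i1; ring.
have aE : a = - u * d' by rewrite -[LHS]mul1r -(expr1n K 2) -sqrrN -i2; ring.
have dE : l ^+ 2 + 2 * d' + 2 * b = 0.
  apply: (mulfI u0); rewrite mulr0.
  transitivity (l' ^+ 2 + 2 * u ^+ 2 * d' + 2 * u ^+ 2 * b);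
    first by rewrite l'E; ring.
  rewrite g1 aE; transitivity (2 * (u ^+ 2 - (u + 1)) * b); first by ring.
  by rewrite u2 subrr mulr0 mul0r.
(* [D(phi)] drops out because its coefficient contains [u ^ 2 - u - 1]. *)
have bE : b + u * l ^+ 2 = 4 * d' - 2 * (u ^+ 2 - u - 1) * (d - (2 * d')).
  by rewrite s g2 aE; ring.
transitivity (b + u * l ^+ 2 + 4 * b - u * l ^+ 2); first by ring.
rewrite bE u2 -[RHS]addr0 -[X in _ = _ + X](mulr0 2) -dE; ring.
Qed.

End FinitePolylog.

(** * Rationals integral at p and their reduction *)

Lemma pintegralP p x :
  reflect (exists u : int, exists2 v : nat, coprime p v & x * v%:R = u%:~R /\ v
    != 0%N)
          (pintegral p x).
Proof.
apply: (iffP idP) => [px|[u [v pv [xv v0]]]].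
  exists (numq x), `|denq x|%N => //; split; last by rewrite absz_eq0 denq_eq0.
  rewrite -{1}[x]divq_num_den natr_absz gtr0_norm ?denq_gt0 // divfK //.
  by rewrite intr_eq0 denq_eq0.
apply: coprime_dvdr pv.
have e : (numq x * v%:Z = u * denq x).
  apply: (@intr_inj rat); rewrite !rmorphM /= -xv -{2}[x]divq_num_den.
  by rewrite mulrAC divfK // intr_eq0 denq_eq0.
have : (denq x %| v%:Z)%Z.
  rewrite -(@Gauss_dvdzr (denq x) (numq x)) ?e ?dvdz_mull //.
  by rewrite coprimezE coprime_sym coprime_num_den.
by rewrite /dvdz.
Qed.

Lemma pintegral_subring p : subring_closed (pintegral p).
Proof.
split=> [|x y|x y]; rewrite ?unfold_in.
- by rewrite /pintegral /= coprimen1.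
- move=> /pintegralP [u [v pv [xv v0]]] /pintegralP [u' [v' pv' [yv v0']]].
  apply/pintegralP; exists (u * v'%:Z - u' * v%:Z), (v * v')%N.
    by rewrite coprimeMr pv.
  rewrite rmorphB !rmorphM /= -xv -yv ?natrM muln_eq0 negb_or v0 v0'; split=> //.
  by rewrite -!pmulrn; ring.
- move=> /pintegralP [u [v pv [xv v0]]] /pintegralP [u' [v' pv' [yv v0']]].
  apply/pintegralP; exists (u * u'), (v * v')%N.
    by rewrite coprimeMr pv.
  rewrite !rmorphM /= -xv -yv ?natrM muln_eq0 negb_or v0 v0'; split=> //.
  by ring.
Qed.

HB.instance Definition _ p :=
  GRing.isSubringClosed.Build rat (pintegral p) (pintegral_subring p).

Lemma pintegral_natV p v : coprime p v -> v != 0%N -> v%:R^-1 \in pintegral p.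
Proof.
move=> pv v0; apply/pintegralP; exists 1, v => //; split=> //.
by rewrite mulVf // pnatr_eq0.
Qed.

Lemma ratcongP p m x y z :
  z \in pintegral p -> p != 0%N -> x = y + p%:R ^+ m * z -> ratcong p m x y.
Proof.
move=> pz p0 ->; rewrite /ratcong addrC addKr natrX mulrAC divff ?mul1r //.
by rewrite expf_neq0 // pnatr_eq0.
Qed.

Section Reduction.
Variables (K : fieldType) (p : nat).
Hypothesis charK : p \in [pchar K].
Let p_prime : prime p := pcharf_prime charK.

Lemma coprime_natr_neq0 v : coprime p v -> v%:R != 0 :> K.
Proof. by move=> pv; rewrite -(dvdn_pcharf charK) -prime_coprime. Qed.

(** [ratr] divides the reduced numerator by the reduced denominator and is no ring morphism in
    characteristic [p]. That any fraction with denominator prime to [p] may be used instead is what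
    makes it additive and multiplicative on [pintegral p]. *)
Lemma ratr_pintegral x v (u : int) :
  coprime p v -> v != 0%N -> x * v%:R = u%:~R -> ratr x * v%:R = u%:~R :> K.
Proof.
move=> pv v0 xv; rewrite /ratr.
have e : (numq x * v%:Z = u * denq x).
  apply: (@intr_inj rat); rewrite !rmorphM /= -xv -{2}[x]divq_num_den.
  by rewrite mulrAC divfK // intr_eq0 denq_eq0.
have px : coprime p `|denq x| by apply/pintegralP; exists u, v.
have d0 : (denq x)%:~R != 0 :> K.
  by have := coprime_natr_neq0 px; rewrite pmulrn gtz0_abs ?denq_gt0.
apply: (mulIf d0); rewrite mulrAC divfK //.
by have := congr1 (fun i : int => i%:~R : K) e; rewrite /= !rmorphM.
Qed.

Lemma ratrD_p x y : x \in pintegral p -> y \in pintegral p ->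
  ratr (x + y) = ratr x + ratr y :> K.
Proof.
move=> /pintegralP [u [v pv [xv v0]]] /pintegralP [u' [v' pv' [yv v0']]].
have vv0 : (v * v')%:R != 0 :> K by rewrite coprime_natr_neq0 // coprimeMr pv.
apply: (mulIf vv0); rewrite (@ratr_pintegral _ _ (u * v'%:Z + u' * v%:Z)).
- rewrite rmorphD !rmorphM /= -(ratr_pintegral pv v0 xv) -(ratr_pintegral pv'
  v0' yv).
  by rewrite ?natrM -!pmulrn; ring.
- by rewrite coprimeMr pv.
- by rewrite muln_eq0 negb_or v0.
- by rewrite rmorphD !rmorphM /= -xv -yv ?natrM -!pmulrn; ring.
Qed.

Lemma ratrM_p x y : x \in pintegral p -> y \in pintegral p ->
  ratr (x * y) = ratr x * ratr y :> K.
Proof.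
move=> /pintegralP [u [v pv [xv v0]]] /pintegralP [u' [v' pv' [yv v0']]].
have vv0 : (v * v')%:R != 0 :> K by rewrite coprime_natr_neq0 // coprimeMr pv.
apply: (mulIf vv0); rewrite (@ratr_pintegral _ _ (u * u')).
- rewrite !rmorphM /= -(ratr_pintegral pv v0 xv) -(ratr_pintegral pv' v0' yv).
  by rewrite ?natrM; ring.
- by rewrite coprimeMr pv.
- by rewrite muln_eq0 negb_or v0.
- by rewrite !rmorphM /= -xv -yv ?natrM; ring.
Qed.

Lemma ratr_sum_p (F : nat -> rat) m : 
  (forall i, (i < m)%N -> F i \in pintegral p) ->
  ratr (\sum_(0 <= i < m) F i) = \sum_(0 <= i < m) ratr (F i) :> K.
Proof.
elim: m => [|m IH] pF; first by rewrite !big_geq // (ratr_nat K 0).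
rewrite !big_nat_recr //= ratrD_p ?IH // => [i hi||].
- by apply: pF; apply: ltnW.
- by rewrite big_nat rpred_sum // => i hi; apply: pF; lia.
- exact: pF.
Qed.

Lemma ratrX_p x m : x \in pintegral p -> ratr (x ^+ m) = ratr x ^+ m :> K.
Proof.
move=> px; elim: m => [|m IH]; first by rewrite !expr0 (ratr_nat K 1).
by rewrite !exprS ratrM_p ?IH // rpredX.
Qed.

Lemma ratrV_p x : x \in pintegral p -> x^-1 \in pintegral p ->
  ratr x^-1 = (ratr x)^-1 :> K.
Proof.
move=> px pVx; have [->|x0] := eqVneq x 0;
  first by rewrite invr0 (ratr_nat K 0) invr0.
have e : ratr x^-1 * ratr x = 1 :> K by
  rewrite -ratrM_p // mulVf // (ratr_nat K 1).
have rx0 : ratr x != 0 :> K.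
  by apply/eqP => r0; move: e; rewrite r0 mulr0 => /eqP; rewrite eq_sym oner_eq0.
by rewrite -[LHS](mulfK rx0) e mul1r.
Qed.

(** The way back from identities in [K] to congruences modulo [p]. *)
Lemma ratr_eq0_p x : x \in pintegral p -> ratr x = 0 :> K ->
  exists2 y, y \in pintegral p & x = p%:R * y.
Proof.
move=> /pintegralP [u [v pv [xv v0]]] rx.
have := ratr_pintegral pv v0 xv; rewrite rx mul0r => /esym/eqP.
have -> : (u%:~R == 0 :> K) = (p %| `|u|)%N.
  by rewrite (dvdn_pcharf charK); case: u {xv} => m //=;
    rewrite NegzE rmorphN oppr_eq0.
move=> /dvdnP [c uc].
have vr0 : v%:R != 0 :> rat by rewrite pnatr_eq0.
exists ((sgz u * c%:Z)%:~R / v%:R).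
  by rewrite rpredM ?rpred_int // pintegral_natV.
apply: (mulIf vr0); rewrite xv mulrA divfK // [u in LHS]intEsg uc.
by rewrite PoszM !rmorphM /= -pmulrn; ring.
Qed.

Lemma ratr_modp x : ratr x ^+ p = ratr x :> K.
Proof.
have h (m : int) : m%:~R ^+ p = m%:~R :> K.
  by rewrite -(pFrobenius_autE charK) rmorph_int.
by rewrite /ratr expr_div_n !h.
Qed.

Lemma ratr_modpX x b : ratr x ^+ (p ^ b) = ratr x :> K.
Proof. by elim: b => [|b IH]; rewrite ?expr1 // expnS exprM ratr_modp. Qed.

(** Lucas' theorem in base [p ^ b]: multiplication by [(1 + X) ^ P = 1 + X ^ P] shifts coefficients
    by [P], whence an induction on [A] by Pascal's rule. *)
Lemma lucas b A B c r : (B < p ^ b)%N -> (r < p ^ b)%N ->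
  'C(A * p ^ b + B, c * p ^ b + r)%:R = 'C(A, c)%:R * 'C(B, r)%:R :> K.
Proof.
move=> hB hr; set P := (p ^ b)%N in hB hr *.
have coefX1 m k : ((1 + 'X) ^+ m : {poly K})`_k = 'C(m, k)%:R.
  rewrite exprDn coef_sum.
  under eq_bigr => i _ do rewrite expr1n mul1r coefMn coefXn.
  have [km|km] := leqP k m.
    rewrite (bigD1 (Ordinal (km : (k < m.+1)%N))) //= eqxx big1 ?addr0 // => i.
    by rewrite -val_eqE /= eq_sym => /negPf ->; rewrite mul0rn.
  rewrite bin_small // big1 // => i _.
  by rewrite gtn_eqF ?mul0rn // (leq_trans (ltn_ord i)).
have step m k : 'C(m + P, k)%:R
    = 'C(m, k)%:R + (if (k < P)%N then 0 else 'C(m, k - P)%:R) :> K.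
  rewrite -!coefX1 exprD [_ ^+ P]exprDn_pchar.
    by rewrite expr1n mulrDr mulr1 coefD coefMXn coefX1.
  by rewrite /P pchar_pnat_expn // pchar_poly.
elim: A c => [|A IH] c.
  case: c => [|c]; first by rewrite !mul0n !add0n bin0 mul1r.
  by rewrite [in RHS]bin0n mul0r mul0n bin_small //; lia.
rewrite (_ : A.+1 * P + B = (A * P + B) + P)%N; last lia.
rewrite step; case: c => [|c].
  by rewrite mul0n add0n hr addr0; have := IH 0%N; rewrite mul0n add0n !bin0.
rewrite ifN; last by rewrite -leqNgt; lia.
rewrite IH (_ : c.+1 * P + r - P = c * P + r)%N; last lia.
by rewrite IH binS natrD; ring.
Qed.

End Reduction.

(** * Valuations of [p ^ b / m] and sums over blocks *)

Lemma pdiv_decomp p m : prime p -> (0 < m)%N ->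
  exists2 e, (p ^ e <= m)%N & exists2 m', coprime p m' & m = (m' * p ^ e)%N.
Proof.
move=> p_prime m_gt0; have [m' pm' mE] := pfactor_coprime p_prime m_gt0.
exists (logn p m); last by exists m'.
by apply: dvdn_leq => //; apply: pfactor_dvdnn.
Qed.

Lemma pintegral_expn_div p b m : prime p -> (0 < m < p ^ b.+1)%N ->
  (p ^ b)%:R / m%:R \in pintegral p.
Proof.
move=> p_prime /andP[m_gt0 m_lt].
have [e em [m' pm' mE]] := pdiv_decomp p_prime m_gt0.
have eb : (e <= b)%N.
  by rewrite -ltnS -(ltn_exp2l _ _ (prime_gt1 p_prime));
    apply: leq_ltn_trans em m_lt.
have pe0 : (p ^ e)%:R != 0 :> rat.
  by rewrite pnatr_eq0 expn_eq0 negb_and -lt0n prime_gt0.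
have m'0 : m' != 0%N by apply/eqP => e0; move: m_gt0; rewrite mE e0.
rewrite -(subnK eb) expnD natrM mE natrM invfM mulrA mulrAC mulfK //.
by rewrite rpredM ?rpred_nat ?pintegral_natV.
Qed.

Lemma pintegral_expn_div_small p b m : prime p -> (0 < m)%N -> ~~ (p ^ b %|
  m)%N ->
  exists2 y, y \in pintegral p & (p ^ b)%:R / m%:R = p%:R * y.
Proof.
move=> p_prime m_gt0 nPm.
have [e em [m' pm' mE]] := pdiv_decomp p_prime m_gt0.
have eb : (e.+1 <= b)%N.
  by rewrite ltnNge; apply: contra nPm => be; rewrite mE dvdn_mull // dvdn_exp2l.
have pe0 : (p ^ e)%:R != 0 :> rat.
  by rewrite pnatr_eq0 expn_eq0 negb_and -lt0n prime_gt0.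
have m'0 : m' != 0%N by apply/eqP => e0; move: m_gt0; rewrite mE e0.
exists ((p ^ (b - e.+1))%:R / m'%:R).
  by rewrite rpredM ?rpred_nat ?pintegral_natV.
rewrite -{1}(subnK eb) expnD expnS !natrM mE natrM.
by field; rewrite pe0 pnatr_eq0 m'0.
Qed.

Lemma sum_nat_blocks (V : zmodType) k P (f : nat -> V) :
  \sum_(0 <= j < k * P) f j
  = \sum_(0 <= i < k) \sum_(0 <= s < P) f (i * P + s)%N.
Proof.
elim: k => [|k IH]; first by rewrite mul0n !big_geq.
rewrite big_nat_recr //= -IH (big_cat_nat (n := (k * P)%N)) //=; last lia.
congr (_ + _); rewrite -{1}[(k * P)%N]add0n big_addn (_ : k.+1 * P - k * P =
  P)%N; last lia.
by apply: eq_bigr => i _; rewrite addnC.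
Qed.

Lemma sum_nat_blocksD (V : zmodType) k P r (f : nat -> V) :
  \sum_(0 <= j < k * P + r) f j
  = \sum_(0 <= i < k) \sum_(0 <= s < P) f (i * P + s)%N
    + \sum_(0 <= s < r) f (k * P + s)%N.
Proof.
rewrite -sum_nat_blocks (big_cat_nat (n := (k * P)%N)) //=; last lia.
congr (_ + _); rewrite -{1}[(k * P)%N]add0n big_addn addKn.
by apply: eq_bigr => i _; rewrite addnC.
Qed.

Lemma sum_congruence p m (c : rat) (f g : nat -> rat) :
  (forall k, (k < m)%N -> exists2 z, z \in pintegral p & f k = g k + c * z) ->
  exists2 z, z \in pintegral p &
  \sum_(0 <= k < m) f k = \sum_(0 <= k < m) g k + c * z.
Proof.
elim: m => [|m IH] h; first by exists 0;
  rewrite ?rpred0 // !big_geq // mulr0 addr0.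
have [k hk|z pz e] := IH; first by apply: h; apply: ltnW.
have [z' pz' e'] := h m (ltnSn m).
by exists (z + z'); rewrite ?rpredD // !big_nat_recr //= e e'; ring.
Qed.

(** * Expansion of the central sum and reduction of its correction *)

Definition central_sum (F : fieldType) n (d : F) : F :=
  \sum_(0 <= k < n.+1) 'C(2 * k, k)%:R / d ^+ k.

(* The second-order term of the expansion below, divided by [p ^ 2]. *)
Definition central_corr P n (d : rat) : rat :=
  \sum_(0 <= k < n.+1) 'C(2 * k, k)%:R / d ^+ k
    * \sum_(0 <= j < k) (P%:R / (2 * j).+1%:R) ^+ 2.

Section Expansion.
Variables (p b n : nat).
Hypotheses (p_prime : prime p) (nE : (2 * n).+1 = (p ^ b.+1)%N).

Let P := (p ^ b)%N.

Lemma odd_ratio_pintegral k j : (k <= n)%N -> (j < k)%N ->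
  (P%:R / (2 * j).+1%:R) ^+ 2 \in pintegral p.
Proof. by move=> hk hj; rewrite rpredX // pintegral_expn_div //; lia. Qed.

Lemma prod_1B_expansion k (c : nat -> rat) : (forall j, (j < k)%N -> c j \in
  pintegral p) ->
  exists2 z, z \in pintegral p &
  \prod_(0 <= j < k) (1 - p%:R ^+ 2 * c j)
  = 1 - p%:R ^+ 2 * \sum_(0 <= j < k) c j + p%:R ^+ 4 * z.
Proof.
elim: k => [|k IH] pc.
  by exists 0; rewrite ?rpred0 // !big_geq // !mulr0 subr0 addr0.
have [j hj|z pz e] := IH; first by apply: pc; apply: ltnW.
have pck := pc k (ltnSn k).
have pS : \sum_(0 <= j < k) c j \in pintegral p.
  by rewrite big_nat rpred_sum // => j hj; apply: pc; lia.
rewrite !big_nat_recr //= e.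
exists (c k * \sum_(0 <= j < k) c j + z - p%:R ^+ 2 * z * c k); last by ring.
by rewrite rpredB ?rpredD ?rpredM ?rpredX ?rpred_nat.
Qed.

Variable d : rat.
Hypothesis dV : d^-1 \in pintegral p.

Lemma central_coef_pintegral k : 'C(2 * k, k)%:R / d ^+ k \in pintegral p.
Proof. by rewrite -exprVn rpredM ?rpred_nat ?rpredX. Qed.

(** [bin_central_prod] with [q / (2j+1) = p * (P / (2j+1))], the product being expanded to first
    order in [p ^ 2]. *)
Lemma central_sum_expansion :
  exists2 z, z \in pintegral p &
  central_sum n d
  = chebU n (-16 / d) + p%:R ^+ 2 * central_corr P n d + p%:R ^+ 4 * z.
Proof.
rewrite /central_sum /chebU /central_corr big_distrr -big_split /=.
apply: sum_congruence => k hk.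
have [j hj|z pz e] := @prod_1B_expansion k (fun j => (P%:R / (2 * j).+1%:R) ^+ 2).
  exact: odd_ratio_pintegral hk hj.
exists (- ('C(2 * k, k)%:R / d ^+ k * z)).
  by rewrite rpredN rpredM ?central_coef_pintegral.
rewrite expr_div_n mulrA bin_central_prod => [|j _|j _|]; rewrite ?pnatr_eq0 //.
rewrite (_ : \prod_(0 <= j < k) _ =
    \prod_(0 <= j < k) (1 - p%:R ^+ 2 * (P%:R / (2 * j).+1%:R) ^+ 2)); last first.
  apply: eq_bigr => j _; rewrite nE expnS natrM -/P.
  by rewrite [in RHS]expr_div_n [in LHS]exprMn [in RHS]mulrA.
by rewrite {}e; ring.
Qed.

End Expansion.

Section ReductionCorr.
Variables (K : fieldType) (p b n n1 nb : nat).
Hypotheses (charK : p \in [pchar K]) (nE : (2 * n).+1 = (p ^ b.+1)%N).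
Hypotheses (n1E : (2 * n1).+1 = p) (nbE : (2 * nb).+1 = (p ^ b)%N).

Let P := (p ^ b)%N.
Let p_prime : prime p := pcharf_prime charK.
Let PE : P = (2 * nb).+1 := esym nbE.

(** Modulo [p] the ratio survives only if [P] divides the denominator. Within a block of length [P]
    this happens once, in the middle, where the denominator is [(2i+1) P]. *)
Let ratr_odd_ratio i s : (s < P)%N -> ((2 * (i * P + s)).+1 < p ^ b.+1)%N ->
  ratr ((P%:R / (2 * (i * P + s)).+1%:R) ^+ 2)
  = if s == nb then ((2 * i).+1%:R ^+ 2)^-1 else 0 :> K.
Proof.
move=> sP mlt.
have pr : P%:R / (2 * (i * P + s)).+1%:R \in pintegral p.
  by rewrite pintegral_expn_div.
rewrite (ratrX_p charK) //; case: eqP => [sE|/eqP sE].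
  rewrite -exprVn; congr (_ ^+ 2).
  have P0 : P%:R != 0 :> rat by rewrite pnatr_eq0 expn_eq0 negb_and -lt0n
    prime_gt0.
  have mE : ((2 * (i * P + s)).+1 = (2 * i).+1 * P)%N by rewrite sE; nia.
  have i_lt : ((2 * i).+1 < p)%N.
    by move: mlt; rewrite mE expnS ltn_mul2r; case/andP.
  have ci : coprime p (2 * i).+1.
    by rewrite prime_coprime // gtnNdvd.
  rewrite mE natrM invfM mulrCA mulfV // mulr1.
  by rewrite (ratrV_p charK) ?rpred_nat ?pintegral_natV // ratr_nat.
have [||y py ->] := @pintegral_expn_div_small p b (2 * (i * P + s)).+1 p_prime
  _ _ => //.
  apply: contra sE => /dvdnP [c ce]; apply/eqP; rewrite -/P in ce.
  (* As [0 < 2s+1 < 2P], the cofactor must be [1], so that [s = nb]. *)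
  have : ((c - 2 * i) * P = (2 * s).+1)%N by rewrite mulnBl; lia.
  case: (c - 2 * i)%N => [|[|c']]; [lia|lia|nia].
by rewrite (ratrM_p charK) ?rpred_nat // ratr_nat (pcharf0 charK) mul0r expr0n.
Qed.

(** Each full block contributes its middle term; the last one, of length [r <= nb], stops before its
    middle. *)
Lemma ratr_odd_harm2 k r : (k <= n1)%N -> (r <= nb)%N ->
  ratr (\sum_(0 <= j < k * P + r) (P%:R / (2 * j).+1%:R) ^+ 2) = odd_harm2 K k.
Proof.
move=> hk hr.
have hn : (n = n1 * P + nb)%N by move: nE; rewrite expnS -/P -{1}n1E; nia.
have hb : (k * P + r <= n)%N by rewrite hn leq_add // leq_mul2r hk orbT.
rewrite (ratr_sum_p charK) => [|j hj].
  rewrite sum_nat_blocksD [X in _ + X]big_nat [X in _ + X]big1 ?addr0 => [|s hs].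
    rewrite /odd_harm2; apply: eq_big_nat => i hi.
    rewrite (eq_big_nat _ _ (F2 := fun s =>
      if s == nb then ((2 * i).+1%:R ^+ 2)^-1 else 0)) => [|s hs].
      rewrite -big_mkcond /= big_nat1_eq ifT //; lia.
    apply: ratr_odd_ratio => //; rewrite -nE hn.
    have : (i.+1 * P <= n1 * P)%N by rewrite leq_mul2r; lia.
    by lia.
  rewrite ratr_odd_ratio ?ltn_eqF //; lia.
by apply: (odd_ratio_pintegral p_prime nE hb).
Qed.

Variable d : rat.
Hypotheses (dp : d \in pintegral p) (dV : d^-1 \in pintegral p).

(** Write the index as [k * P + r]. If [r <= nb], Lucas' theorem and [d ^ P = d] in [K] factor the
    coefficient, and the inner sum depends on [k] only. If [r > nb], doubling carries and the lower
    binomial [C(2r - P, r)] vanishes. Hence a product: the central sum at [p ^ b] times the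
    correction at [p]. *)
Lemma ratr_central_corr :
  ratr (central_corr P n d)
  = central_sum nb (ratr d)
    * \sum_(0 <= k < n1.+1) 'C(2 * k, k)%:R / ratr d ^+ k * odd_harm2 K k :> K.
Proof.
have hn : (n.+1 = n1 * P + nb.+1)%N by move: nE; rewrite expnS -/P -{1}n1E; nia.
have Pn : (nb.+1 <= P)%N by lia.
rewrite /central_corr (ratr_sum_p charK) => [|k hk]; last first.
  rewrite rpredM ?central_coef_pintegral // big_nat rpred_sum // => j hj.
  by apply: (odd_ratio_pintegral p_prime nE (_ : k <= n)%N) => //; lia.
rewrite {1}hn sum_nat_blocksD.
pose c k : K := 'C(2 * k, k)%:R / ratr d ^+ k.
have rc k : ratr ('C(2 * k, k)%:R / d ^+ k) = c k.
  by rewrite -exprVn (ratrM_p charK) ?rpred_nat ?rpredX // ratr_nat (ratrX_p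
    charK) // (ratrV_p charK) // exprVn.
have cM k r : (r < P)%N -> c (k * P + r)%N = if (r <= nb)%N then c k * c r else 0.
  move=> rP; rewrite /c; case: leqP => hr.
    rewrite (_ : 2 * (k * P + r) = 2 * k * P + 2 * r)%N; last lia.
    rewrite /P (lucas charK) -/P //; last lia.
    have dP : ratr d ^+ P = ratr d :> K by apply: ratr_modpX.
    by rewrite exprD [X in _ ^+ X * _]mulnC exprM dP invfM; ring.
  rewrite (_ : 2 * (k * P + r) = (2 * k).+1 * P + (2 * r - P))%N; last first.
    by lia.
  rewrite /P (lucas charK) -/P //; last lia.
  by rewrite [X in _ * X%:R](@bin_small (2 * r - P)) ?mulr0 ?mul0r //; lia.
have tE k r : (k <= n1)%N -> (r < P)%N -> (k * P + r < n.+1)%N ->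
  ratr ('C(2 * (k * P + r), k * P + r)%:R / d ^+ (k * P + r)
    * \sum_(0 <= j < k * P + r) (P%:R / (2 * j).+1%:R) ^+ 2)
  = if (r <= nb)%N then c k * odd_harm2 K k * c r else 0 :> K.
  move=> hk hr hkr; rewrite (ratrM_p charK) ?central_coef_pintegral //;
    last first.
    rewrite big_nat rpred_sum // => j hj.
    by apply: (odd_ratio_pintegral p_prime nE (_ : k * P + r <= n)%N) => //; lia.
  rewrite rc cM //; case: leqP => hb; last by rewrite mul0r.
  by rewrite ratr_odd_harm2 // mulrAC.
rewrite big_distrr [in RHS]big_nat_recr //=; congr (_ + _).
  apply: eq_big_nat => k hk; rewrite (big_cat_nat (n := nb.+1)) //=.
  rewrite [X in _ + X]big_nat [X in _ + X]big1 ?addr0 => [|r hr]; last first.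
    rewrite tE; [by rewrite ifN //; lia|lia|lia|].
    have : (k.+1 * P <= n1 * P)%N by rewrite leq_mul2r; lia.
    by lia.
  rewrite /central_sum mulrC big_distrr; apply: eq_big_nat => r hr /=.
  rewrite tE; [by rewrite ifT //; lia|lia|lia|].
  have : (k.+1 * P <= n1 * P)%N by rewrite leq_mul2r; lia.
  by lia.
rewrite /central_sum mulrC big_distrr; apply: eq_big_nat => r hr /=.
by rewrite tE; [rewrite ifT //; lia|lia|lia|lia].
Qed.

End ReductionCorr.

(** * Fermat and Lucas quotients *)

Lemma ex_closed_field_pchar p : prime p ->
  exists K : closedFieldType, p \in [pchar K].
Proof.
move=> p_prime; have [K [f _]] := countable_algebraic_closure 'F_p.
by exists K; rewrite (fmorph_pchar f) pchar_Fp.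
Qed.

Lemma intr_pchar_eq0 (K : fieldType) p (m : int) : p \in [pchar K] ->
  m%:~R = 0 :> K -> exists c, m = p%:Z * c.
Proof.
move=> charK m0; suff /dvdzP [c ->] : (p%:Z %| m)%Z by exists c; rewrite mulrC.
rewrite dvdzE absz_nat (dvdn_pcharf charK); move: m0; case: m => k;
  first by move=> /eqP.
by rewrite NegzE rmorphN => /eqP; rewrite oppr_eq0.
Qed.

Section FermatQuotients.
Variables (K : fieldType) (p n : nat).
Hypotheses (pE : p = (2 * n).+1) (charK : p \in [pchar K]).
Let p_prime : prime p := pcharf_prime charK.

Lemma binp1_pchar j : (j < p)%N -> 'C(p.-1, j)%:R = (-1) ^+ j :> K.
Proof.
elim: j => [|j IH] hj; first by rewrite bin0.
have : 'C(p, j.+1)%:R = 0 :> K.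
  by apply/eqP; rewrite -(dvdn_pcharf charK) prime_dvd_bin.
rewrite -{1}(prednK (prime_gt0 p_prime)) binS natrD IH; last exact: ltnW.
by move/eqP; rewrite addr_eq0 exprS mulN1r => /eqP.
Qed.

(** [C(p, k) / p] reduces to [- (-1) ^ k / k]. The sequence [c] is arbitrary so as to cover powers
    of [2] and Lucas numbers. *)
Lemma fermat_quotient_sum (c : nat -> int) (v : int) :
  \sum_(1 <= k < p) (-1) ^+ k * 'C(p, k)%:Z * c k = p%:Z * v ->
  \sum_(1 <= k < p) (c k)%:~R / k%:R = - v%:~R :> K.
Proof.
move=> e.
have p0 : p%:Z != 0 by rewrite eqz_nat -lt0n prime_gt0.
have -> : v = \sum_(1 <= k < p) (-1) ^+ k * ('C(p, k) %/ p)%N%:Z * c k.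
  apply: (mulfI p0); rewrite -e big_distrr; apply: eq_big_nat => k hk /=.
  rewrite -{1}(divnK (prime_dvd_bin p_prime hk)) PoszM; ring.
rewrite rmorph_sum -sumrN; apply: eq_big_nat => k hk /=.
rewrite !rmorphM /= rmorphXn /= rmorphN1 -pmulrn.
have k0 : k%:R != 0 :> K by rewrite -(dvdn_pcharf charK) gtnNdvd; lia.
have -> : ('C(p, k) %/ p)%:R = - (-1) ^+ k / k%:R :> K.
  apply: (canRL (mulfK k0)).
  have -> : - (-1) ^+ k = 'C(p.-1, k.-1)%:R :> K.
    rewrite binp1_pchar; last lia.
    by rewrite -{1}(prednK (_ : 0 < k)%N) ?exprS ?mulN1r ?opprK //; lia.
  rewrite -natrM; congr _%:R; apply/eqP;
    rewrite -(eqn_pmul2r (prime_gt0 p_prime)).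
  rewrite mulnAC divnK ?prime_dvd_bin //.
  have := mul_bin_diag p k.-1; rewrite prednK; last lia.
  by move=> h; apply/eqP; lia.
rewrite mulrA mulrN -exprMn mulrNN mulr1 expr1n.
by rewrite mulN1r mulNr opprK mulrC.
Qed.

(** Binomial expansion of [(1 - 2) ^ p = -1], without its two end terms. *)
Lemma fpolylog1_2 (v : int) : 2 ^+ p - 2 = p%:Z * v ->
  fpolylog p 1 2 = - v%:~R :> K.
Proof.
move=> e; rewrite (fpolylogE pE charK) //.
rewrite -(@fermat_quotient_sum (fun k => 2 ^+ k)).
  by apply: eq_bigr => k _; rewrite rmorphXn.
have : (1 - 2 : int) ^+ p = -1.
  by rewrite (_ : 1 - 2 = -1) // -signr_odd pE /= oddM.
rewrite exprBn -(big_mkord xpredT (fun i =>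
  ((-1) ^+ i * 1 ^+ (p - i) * 2 ^+ i) *+ 'C(p, i))).
rewrite big_ltn // -e big_nat_recr /=; last by rewrite pE.
rewrite !expr1n bin0 binn.
have -> : (-1) ^+ p = -1 :> int by rewrite -signr_odd pE /= oddM.
rewrite !expr0 !mulr1 => h.
transitivity (\sum_(1 <= i < p) ((-1) ^+ i * 1 ^+ (p - i) * 2 ^+ i) *+ 'C(p, i)
  : int).
  by apply: eq_bigr => k _; rewrite expr1n mulr1 -[RHS]mulr_natr mulrAC;
    congr (_ * _); rewrite natz.
by move: h; rewrite mulr1n; move: (\sum_(_ <= i < _) _) (2 ^+ p) => A B; lia.
Qed.

End FermatQuotients.

(** The Lucas number [F_(m+1) + F_(m-1)], written without a predecessor so that index [0] gives
    [2]. *)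
Definition luc (m : nat) : int := 2 * (fib m.+1)%:Z - (fib m)%:Z.

Lemma fibSS m : fib m.+2 = (fib m.+1 + fib m)%N.
Proof. by []. Qed.

Lemma fib_golden (R : comNzRingType) (phi : R) m : phi ^+ 2 = phi + 1 ->
  phi ^+ m.+1 = (fib m.+1)%:R * phi + (fib m)%:R.
Proof.
move=> phi2; elim: m => [|m IH]; first by rewrite expr1 mul1r addr0.
rewrite exprSr IH fibSS natrD mulrDl -mulrA -expr2 phi2; ring.
Qed.

Lemma luc_golden (R : comNzRingType) (phi : R) m : phi ^+ 2 = phi + 1 ->
  (luc m)%:~R = phi ^+ m + (1 - phi) ^+ m.
Proof.
move=> phi2; have psi2 : (1 - phi) ^+ 2 = (1 - phi) + 1.
  by transitivity (phi ^+ 2 - phi - phi + 1); [|rewrite phi2]; ring.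
case: m => [|m]; first by rewrite /luc !expr0 rmorphB rmorphM /=; ring.
rewrite (fib_golden m phi2) (fib_golden m psi2) /luc fibSS;
  move: (fib m.+1) (fib m) => A B.
rewrite PoszD rmorphB rmorphM rmorphD /= -!pmulrn; ring.
Qed.

Lemma ex_golden_algC : exists phi : algC, phi ^+ 2 = phi + 1.
Proof.
by exists ((1 + sqrtC 5) / 2); rewrite expr_div_n sqrrD sqrtCK; field.
Qed.

(** Expand the [p]-th powers of [phi = 1 - (1 - phi)] and of [1 - phi]; the identity is checked in
    [algC] and descends to integers. *)
Lemma luc_bin p : \sum_(0 <= k < p.+1) (-1) ^+ k * 'C(p, k)%:Z * luc k = luc p.
Proof.
have [phi phi2] := ex_golden_algC.
apply: (@intr_inj algC); rewrite rmorph_sum [RHS](luc_golden _ phi2).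
rewrite -{1}[phi](subKr 1) [(1 - (1 - phi)) ^+ p]exprBn [(1 - phi) ^+ p]exprBn.
rewrite big_mkord -big_split /=; apply: eq_bigr => k _.
rewrite !rmorphM /= (luc_golden _ phi2) rmorphXn rmorphN1 -pmulrn !expr1n.
by rewrite -mulrnDl -[RHS]mulr_natr; ring.
Qed.

(** By symmetry [2 L(phi) = L(phi) + L(1 - phi)], a sum of [L_k / k] over Lucas numbers; [luc_bin]
    makes it a quotient by [p]. *)
Lemma fpolylog1_golden (K : fieldType) p n (phi : K) (l : int) :
  p = (2 * n).+1 -> p \in [pchar K] -> phi ^+ 2 = phi + 1 ->
  luc p - 1 = p%:Z * l -> fpolylog p 1 phi = - l%:~R.
Proof.
move=> pE charK phi2 e.
have two_neq0 : 2 != 0 :> K.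
  by rewrite -(dvdn_pcharf charK) gtnNdvd //;
    have := prime_gt1 (pcharf_prime charK); lia.
apply: (mulfI two_neq0).
rewrite mulr_natl mulr2n -{1}(fpolylog1_sym pE charK) !(fpolylogE pE charK) //.
have -> : 2 * - l%:~R = - (2 * l)%:~R :> K by rewrite rmorphM mulrN.
rewrite -big_split /=.
rewrite -(@fermat_quotient_sum K p n pE charK luc).
  by apply: eq_bigr => k _; rewrite (luc_golden _ phi2) addrC mulrDl.
have := luc_bin p; rewrite big_ltn // big_nat_recr; last by rewrite pE.
have -> : (-1) ^+ p = -1 :> int by rewrite -signr_odd pE /= oddM.
rewrite /= bin0 binn expr0 (_ : luc 0 = 2) // mulrCA -e.
by move: (\sum_(_ <= i < _) _) (luc p) => A B; lia.
Qed.

(** * Euler's criterion for [2] through Frobenius on its square root *)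

Section EulerTwo.
Variables (K : closedFieldType) (p : nat).
Hypotheses (charK : p \in [pchar K]) (p_odd : odd p).
Let p_prime : prime p := pcharf_prime charK.

Lemma prime_field_root (s : K) : s ^+ p = s -> exists2 x, (x < p)%N & s = x%:R.
Proof.
move=> sp.
have [/mapP [x]|snin] := boolP (s \in [seq x%:R | x <- iota 0 p]).
  by rewrite mem_iota add0n => /andP[_ xp] ->; exists x.
pose f : {poly K} := 'X^p - 'X.
have size_f : size f = p.+1.
  by rewrite size_polyDl size_polyXn // size_polyN size_polyX ltnS prime_gt1.
have f0 : f != 0 by rewrite -size_poly_gt0 size_f.
have rootf y : (root f y) = (y ^+ p == y).
  by rewrite rootE !hornerE subr_eq0.
have := @max_poly_roots _ f (s :: [seq x%:R | x <- iota 0 p]) f0.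
rewrite /= rootf sp eqxx snin size_map size_iota size_f ltnn /= => H.
suff : false by []; apply: H.
  apply/allP => y /mapP [x _ ->].
  by rewrite rootf -(pFrobenius_autE charK) pFrobenius_aut_nat.
rewrite map_inj_in_uniq ?iota_uniq // => x y.
rewrite !mem_iota !add0n /= => xp yp /eqP.
wlog le_xy : x y xp yp / (x <= y)%N => [hw|].
  by case: (leqP x y) => [/hw|/ltnW /hw]; [apply|rewrite eq_sym => h /h ->].
rewrite eq_sym -subr_eq0 -natrB // -(dvdn_pcharf charK).
have [->|lt_xy] := eqVneq x y; first by [].
by rewrite gtnNdvd //; lia.
Qed.

Lemma natr_eq_modp x y : (x%:R == y%:R :> K) = (x == y %[mod p])%N.
Proof.
wlog le_xy : x y / (x <= y)%N => [hw|].
  by case: (leqP x y) => [/hw|/ltnW /hw h] //; rewrite eq_sym h eq_sym.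
by rewrite eq_sym [RHS]eq_sym eqn_mod_dvd // -subr_eq0 -natrB // (dvdn_pcharf
  charK).
Qed.

(** [s ^ p] is a square root of [2], hence [s] or [- s]; it is [s] exactly when [s] lies in the
    prime field, i.e. when [2] is a square modulo [p]. *)
Lemma legendre2_sqrt (s : K) : s ^+ 2 = 2 -> s ^+ p = (legendre 2 p)%:~R * s.
Proof.
move=> s2; rewrite /legendre.
have p2 : (2 < p)%N by have := prime_gt1 p_prime;
  have := odd_prime_gt2 p_odd p_prime.
rewrite ifN; last by rewrite dvdzE absz_nat gtnNdvd.
case: ifP => [/existsP [x]|/negbT/existsPn hx].
  rewrite expr2 -PoszM !modz_nat eqz_nat -natr_eq_modp natrM -expr2 -s2 eqf_sqr.
  have xp : (val x)%:R ^+ p = (val x)%:R :> K.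
    by rewrite -(pFrobenius_autE charK) pFrobenius_aut_nat.
  rewrite mul1r => /orP[/eqP <- //|/eqP xs].
  by rewrite -[s]opprK -xs exprNn -signr_odd p_odd expr1 mulN1r xp.
have : (s ^+ p) ^+ 2 = s ^+ 2.
  by rewrite exprAC s2 -(pFrobenius_autE charK) pFrobenius_aut_nat.
move/eqP; rewrite eqf_sqr => /orP[/eqP sp|/eqP ->]; last by rewrite mulN1r.
have [x xp sx] := prime_field_root sp.
have := hx (Ordinal xp); rewrite expr2 -PoszM !modz_nat eqz_nat -natr_eq_modp
  natrM.
by rewrite -sx -expr2 s2 eqxx.
Qed.

Lemma exp2_legendre n b : (2 * n).+1 = (p ^ b)%N ->
  2 ^+ n = (legendre 2 p)%:~R ^+ b :> K.
Proof.
move=> nE.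
have [s] : exists s : K, root ('X^2 - 2%:P) s.
  by apply/closed_rootP; rewrite size_XnsubC.
rewrite rootE !hornerE subr_eq0 => /eqP s2.
have s0 : s != 0.
  apply/eqP => s0; move: s2; rewrite s0 expr0n /= => /esym/eqP.
  by rewrite -(dvdn_pcharf charK) gtnNdvd // odd_prime_gt2.
apply: (mulfI s0); rewrite -s2 -exprM -exprS nE mulrC.
elim: b {nE} => [|b IH]; first by rewrite expr1 mul1r.
rewrite expnSr exprM IH exprMn (legendre2_sqrt s2) [in RHS]exprSr -[RHS]mulrA.
by congr (_ * _); rewrite -exprM mulnC exprM -(pFrobenius_autE charK) rmorph_int.
Qed.

End EulerTwo.

Lemma legendre_sign m q : ~~ (q%:Z %| m)%Z -> legendre m q = 1 \/ legendre m q
  = -1.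
Proof. by move=> h; rewrite /legendre (negPf h); case: ifP; [left|right]. Qed.

Lemma jacobi_prime_power m p a : prime p -> (0 < a)%N ->
  jacobi m (p ^ a) = legendre m p ^+ a.
Proof.
move=> pp a0; rewrite /jacobi primesX // primes_prime // big_seq1.
by rewrite lognX logn_prime // eqxx muln1.
Qed.

Lemma half_oddK m : odd m -> (2 * ((m - 1) %/ 2)).+1 = m.
Proof. by move=> om; lia. Qed.

Lemma exprD_mul_expansion (R : comNzRingType) m (c y z : R) :
  exists w, (y + c * z) ^+ m.+1
    = y ^+ m.+1 + m.+1%:R * c * z * y ^+ m + c ^+ 2 * w.
Proof.
elim: m => [|m [w IH]]; first by exists 0; rewrite !expr1 expr0; ring.
exists (y * w + m.+1%:R * z ^+ 2 * y ^+ m + c * z * w).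
rewrite exprS IH !exprS -[m.+2]addn1 natrD; ring.
Qed.

Lemma exprDp_mod_sqr (R : comNzRingType) p (y z : R) : (0 < p)%N ->
  exists w, (y + p%:R * z) ^+ p = y ^+ p + p%:R ^+ 2 * w.
Proof.
case: p => // m _; have [w ->] := exprD_mul_expansion m m.+1%:R y z.
by exists (z * y ^+ m + w); ring.
Qed.

Lemma natr_modpX (K : fieldType) p b m : p \in [pchar K] ->
  m%:R ^+ (p ^ b) = m%:R :> K.
Proof. by move=> charK; rewrite -[m%:R](ratr_nat K) (ratr_modpX charK). Qed.

Section CentralSumMod.
Variables (K : fieldType) (p b n : nat) (d : rat).
Hypotheses (charK : p \in [pchar K]) (nE : (2 * n).+1 = (p ^ b)%N).
Hypotheses (dp : d \in pintegral p) (dV : d^-1 \in pintegral p).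
Let p_prime : prime p := pcharf_prime charK.

Let xp : -16 / d \in pintegral p.
Proof. by rewrite rpredM // rpredN rpred_nat. Qed.

Lemma central_corr_pintegral b' : b = b'.+1 ->
  central_corr (p ^ b') n d \in pintegral p.
Proof.
move=> bE; have nE' : (2 * n).+1 = (p ^ b'.+1)%N by rewrite -bE.
rewrite /central_corr big_nat rpred_sum // => k hk.
rewrite rpredM ?central_coef_pintegral // big_nat rpred_sum // => j hj.
by apply: (odd_ratio_pintegral p_prime nE' (_ : k <= n)%N) => //; lia.
Qed.

(** The expansion modulo [p] alone; it evaluates the first factor of [ratr_central_corr]. *)
Lemma central_sum_chebU : central_sum n (ratr d) = chebU n (-16 / ratr d) :> K.
Proof.
have -> : -16 / ratr d = ratr (-16 / d) :> K.
  by rewrite (ratrM_p charK) ?rpredN ?rpred_nat // (ratrV_p charK) // (ratr_int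
    K (-16)).
(* The expansion needs a positive exponent; for [b = 0] both sums reduce to the term [1]. *)
case bE : b nE => [|b'] nE'.
  have -> : n = 0%N by move: nE'; rewrite expn0; lia.
  by rewrite /central_sum /chebU !big_nat1 !expr0 !bin0 invr1.
have [z pz e] := central_sum_expansion p_prime nE' dV.
have {e} e := congr1 (fun x => ratr x : K) e; rewrite /= in e.
have pC := central_corr_pintegral bE.
have pU : chebU n (-16 / d) \in pintegral p.
  by rewrite /chebU big_nat rpred_sum // => k _;
    rewrite rpredM ?rpred_nat ?rpredX.
have p0 m y : (0 < m)%N -> y \in pintegral p -> ratr (p%:R ^+ m * y) = 0 :> K.
  move=> m0 py; rewrite (ratrM_p charK) ?rpredX ?rpred_nat //.
  by rewrite -natrX ratr_nat natrX (pcharf0 charK) expr0n gtn_eqF // mul0r.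
move: e; rewrite (ratrD_p charK) ?rpredD ?rpredM ?rpredX ?rpred_nat //.
rewrite (ratrD_p charK) ?rpredM ?rpredX ?rpred_nat //.
rewrite !p0 // !addr0.
rewrite /central_sum /chebU.
rewrite (ratr_sum_p charK) => [|k _]; last by rewrite central_coef_pintegral.
rewrite (ratr_sum_p charK) => [|k _]; last by rewrite rpredM ?rpred_nat ?rpredX.
move=> e; transitivity (\sum_(0 <= k < n.+1) ratr ('C(2 * k, k)%:R / d ^+ k) : K).
  apply: eq_bigr => k _; rewrite -[in RHS]exprVn (ratrM_p charK) ?rpred_nat
    ?rpredX //.
  by rewrite ratr_nat (ratrX_p charK) // (ratrV_p charK) // exprVn.
rewrite e; apply: eq_bigr => k _.
by rewrite (ratrM_p charK) ?rpred_nat ?rpredX // ratr_nat (ratrX_p charK).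
Qed.

End CentralSumMod.

Lemma natr_neq0_pchar (K : fieldType) p k : p \in [pchar K] -> (0 < k < p)%N ->
  k%:R != 0 :> K.
Proof. by move=> charK hk; rewrite -(dvdn_pcharf charK) gtnNdvd; lia. Qed.

Lemma coprime_odd_exp2 p k : odd p -> coprime p (2 ^ k).
Proof. by move=> op; apply: coprimeXr; rewrite coprimen2. Qed.

(** Everything is evaluated at [t = 2], [x = 1/2]: the first factor is [(2/p) ^ b], the second comes
    from [D(2)]. *)
Lemma central_sum_m32_corr (K : closedFieldType) p b n (v : int) :
  p \in [pchar K] -> odd p -> p <> 3%N -> (2 * n).+1 = (p ^ b.+1)%N ->
  2 ^+ p - 2 = p%:Z * v ->
  24 * ratr (central_corr (p ^ b) n (-32)) 
  = - (legendre 2 p ^+ b.+1 * v ^+ 2)%:~R :> K.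
Proof.
move=> charK p_odd p3 nE vE; have p_prime := pcharf_prime charK.
have p_gt3 : (3 < p)%N by have := odd_prime_gt2 p_odd p_prime; lia.
have dp : -32 \in pintegral p by rewrite rpredN rpred_nat.
have dV : (-32)^-1 \in pintegral p.
  by rewrite invrN rpredN (pintegral_natV (@coprime_odd_exp2 p 5 p_odd)).
have n1E := half_oddK p_odd; set n1 := ((p - 1) %/ 2)%N in n1E.
have pb_odd : odd (p ^ b) by rewrite oddX p_odd orbT.
have nbE := half_oddK pb_odd; set nb := ((p ^ b - 1) %/ 2)%N in nbE.
have two0 : 2 != 0 :> K by apply: (natr_neq0_pchar charK); lia.
have three0 : 3 != 0 :> K by apply: (natr_neq0_pchar charK); lia.
have d32 : ratr (-32) = -32 :> K by exact: (ratr_int K (-32)).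
have x2 : -16 / -32 = 2^-1 :> K.
  by field; rewrite two0 oppr_eq0 (natrM K 4 8) (natrM K 2 4) (natrM K 2 2)
    !mulf_neq0.
rewrite (ratr_central_corr charK nE n1E nbE dp dV).
rewrite (central_sum_chebU charK nbE dp dV) d32 x2.
have tx : 2 * 2^-1 = (2 - 1) ^+ 2 :> K by rewrite divff //; ring.
have eU := chebUE nb tx.
have eC := central_sum_odd_harm2 (esym n1E) charK p_gt3 tx.
rewrite (exp2_legendre charK p_odd nbE) nbE natr_modpX // in eU.
rewrite (@exp2_legendre _ _ charK p_odd n1 1) ?expn1 // expr1 in eC.
have eD := fpolylog_2 (esym n1E) charK p_gt3.
rewrite (fpolylog1_2 (esym n1E) charK vE) sqrrN in eD.
rewrite (_ : \sum_(0 <= k < n1.+1) _ = \sum_(0 <= k < n1.+1) 'C(2 * k, k)%:R /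
  (-16) ^+ k * 2^-1 ^+ k * odd_harm2 K k); last first.
  apply: eq_bigr => k _; congr (_ * _); rewrite -mulrA; congr (_ * _).
  by rewrite exprVn -invfM -exprMn; congr (_ ^+ _)^-1; ring.
have eta2 : (legendre 2 p) ^+ 2 = 1.
  by case: (@legendre_sign 2 p) => [|->|->] //;
    rewrite dvdzE absz_nat gtnNdvd // odd_prime_gt2.
have {eta2} eta2 : (legendre 2 p)%:~R ^+ 2 = 1 :> K.
  by rewrite -rmorphXn /= eta2.
have etab2 : ((legendre 2 p)%:~R ^+ b) ^+ 2 = 1 :> K by
  rewrite exprAC eta2 expr1n.
rewrite rmorphM !rmorphXn /= exprS.
set C := \sum_(0 <= k < n1.+1) _ in eC *; set U := chebU nb _ in eU *.
set h1 := (legendre 2 p)%:~R in eta2 etab2 eC eU *; set V := v%:~R in eD *.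
set h := h1 ^+ b in etab2 eU *.
have UE : U = h.
  apply: (mulfI three0); transitivity (h ^+ 2 * (3 * U));
    first by rewrite etab2 mul1r.
  transitivity (h * (h * (1 + 2) * U)); first by ring.
  by rewrite eU; ring.
have CE : 24 * C = - (h1 * V ^+ 2).
  transitivity (h1 ^+ 2 * (24 * C)); first by rewrite eta2 mul1r.
  transitivity (h1 * (8 * (h1 * (1 + 2) * C))); first by ring.
  by rewrite eC -mulrN -eD; field.
rewrite UE mulrCA CE; ring.
Qed.

(** * The golden ratio in characteristic p *)

Definition sgn5 (m : nat) : int :=
  if (m %% 5 == 0)%N then 0
  else if (m %% 5 == 1)%N || (m %% 5 == 4)%N then 1 else -1.

Lemma jacobi5 m : jacobi m%:Z 5 = sgn5 m.
Proof.
rewrite /jacobi (_ : primes 5 = [:: 5%N]) // big_seq1 logn_prime // expr1.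
rewrite /legendre /sgn5 dvdzE !absz_nat /dvdn; case: eqP => // /eqP m5.
suff -> : [exists x : 'I_5, (x%:Z ^+ 2 == m%:Z %[mod 5%N%:Z])%Z]
  = (m %% 5 == 1)%N || (m %% 5 == 4)%N by [].
apply/existsP/idP => [[[x x5]]|].
  rewrite expr2 -PoszM !modz_nat eqz_nat /=; move: x x5 => x x5 /eqP h.
  by case: x x5 h => [|[|[|[|[|x]]]]] //= _; lia.
case/orP => /eqP h.
  by exists (Ordinal (isT : 1 < 5)%N); rewrite expr2 -PoszM !modz_nat eqz_nat h.
by exists (Ordinal (isT : 2 < 5)%N); rewrite expr2 -PoszM !modz_nat eqz_nat h.
Qed.

Lemma sgn5M m k : sgn5 (m * k) = sgn5 m * sgn5 k.
Proof.
rewrite /sgn5 -modnMm; have := ltn_pmod m (isT : 0 < 5)%N.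
have := ltn_pmod k (isT : 0 < 5)%N.
by move: (m %% 5)%N (k %% 5)%N => [|[|[|[|[|?]]]]] // [|[|[|[|[|?]]]]].
Qed.

Lemma sgn5_sign m : ~~ (5 %| m)%N -> sgn5 m = 1 \/ sgn5 m = -1.
Proof. by rewrite /sgn5 /dvdn => /negPf ->; case: ifP; [left|right]. Qed.

Lemma prime_power_not_dvd5 p b : prime p -> p <> 5%N -> ~~ (5 %| p ^ b)%N.
Proof.
move=> pp p5; rewrite Euclid_dvdX // negb_and dvdn_prime2 //.
by apply/orP; left; apply/eqP => e; apply: p5.
Qed.

Section Golden.
Variables (K : closedFieldType) (p : nat).
Hypotheses (charK : p \in [pchar K]) (p5 : p <> 5%N).
Let p_prime : prime p := pcharf_prime charK.

(* The golden ratio is [- (zeta ^+ 2 + zeta ^+ 3)] for a fifth root of unity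
   [zeta], so Frobenius acts on it through the residue of the exponent mod 5. *)
Lemma ex_golden_frobenius : exists phi : K, phi ^+ 2 = phi + 1 /\
  forall b, phi ^+ (p ^ b) = if sgn5 (p ^ b) == 1 then phi else 1 - phi.
Proof.
have [z] : exists z : K, root (Poly [:: 1; 1; 1; 1; 1]) z.
  by apply/closed_rootP; rewrite (@PolyK _ 0) //= oner_neq0.
rewrite rootE horner_Poly /= => /eqP; rewrite mul0r add0r mul1r => z4.
have z5 : z ^+ 5 = 1.
  apply/eqP; rewrite -subr_eq0; apply/eqP.
  transitivity ((z - 1) * ((((z + 1) * z + 1) * z + 1) * z + 1)); first by ring.
  by rewrite z4 mulr0.
pose phi := - (z ^+ 2 + z ^+ 3).
have phiE : phi = 1 + z + z ^+ 4.
  rewrite -[LHS]addr0 -z4 /phi; ring.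
have phi2 : phi ^+ 2 = phi + 1.
  transitivity (z ^+ 4 + 2 * z ^+ 5 + z * z ^+ 5); first by rewrite /phi; ring.
  by rewrite z5 phiE; ring.
exists phi; split=> // b.
have hP : [pchar K].-nat (p ^ b)%N by exact: pchar_pnat_expn.
rewrite {1}/phi exprNn_pchar // exprDn_pchar // ![_ ^+ _ ^+ (p ^ b)]exprAC.
rewrite -(expr_mod (p ^ b)%N z5).
have := prime_power_not_dvd5 b p_prime p5; rewrite /dvdn /sgn5.
have := ltn_pmod (p ^ b)%N (isT : 0 < 5)%N.
move: (p ^ b %% 5)%N => [|[|[|[|[|?]]]]] //= _ _.
(* The subtracted terms are multiples of [1 + z + ... + z ^ 4] and [z ^ 5 - 1], chosen to make the
   identity polynomial in [z]. *)
- transitivity (1 - phi - ((((z + 1) * z + 1) * z + 1) * z + 1) - z * (z ^+ 5 -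
  1)); first by rewrite /phi; ring.
  by rewrite z4 z5 subrr mulr0 !subr0.
- transitivity (1 - phi - ((((z + 1) * z + 1) * z + 1) * z + 1) - (z + z ^+ 4)
  * (z ^+ 5 - 1)); first by rewrite /phi; ring.
  by rewrite z4 z5 subrr mulr0 !subr0.
- transitivity (phi - (z ^+ 3 + z ^+ 7 + z ^+ 2) * (z ^+ 5 - 1));
  first by rewrite /phi; ring.
  by rewrite z5 subrr mulr0 !subr0.
Qed.

Variable phi : K.
Hypotheses (phi2 : phi ^+ 2 = phi + 1)
  (phiF : forall b, phi ^+ (p ^ b) = if sgn5 (p ^ b) == 1 then phi else 1 - phi).

Lemma sqrt5_neq0 : 2 * phi - 1 != 0.
Proof.
suff : (2 * phi - 1) ^+ 2 != 0 by rewrite expf_eq0.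
have -> : (2 * phi - 1) ^+ 2 = 5 by transitivity (4 * phi ^+ 2 - 4 * phi + 1);
  [|rewrite phi2]; ring.
by rewrite -(dvdn_pcharf charK) dvdn_prime2 //; apply/eqP.
Qed.

Let sgnP b : sgn5 (p ^ b) = 1 \/ sgn5 (p ^ b) = -1.
Proof. exact/sgn5_sign/prime_power_not_dvd5. Qed.

(** Compare the Frobenius image of [phi] with [fib_golden]. As [phi] may lie in the prime field, one
    equation is not enough: the conjugate equation is added, and the determinant [2 phi - 1] is a
    nonzero square root of [5]. *)
Lemma fib_prime_power b m : m.+1 = (p ^ b)%N ->
  (fib m.+1)%:R = (sgn5 (p ^ b))%:~R :> K /\
  (fib m)%:R = (sgn5 (p ^ b) != 1)%:R :> K.
Proof.
move=> mE.
have e1 := fib_golden m phi2; rewrite {1}mE phiF in e1.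
have psi2 : (1 - phi) ^+ 2 = (1 - phi) + 1.
  by transitivity (phi ^+ 2 - phi - phi + 1); [|rewrite phi2]; ring.
have e2 := fib_golden m psi2.
have hP : [pchar K].-nat (p ^ b)%N by exact: pchar_pnat_expn.
rewrite {1}mE exprDn_pchar // exprNn_pchar // expr1n phiF in e2.
have s := sqrt5_neq0.
move: (fib m.+1)%:R (fib m)%:R e1 e2 => A B.
have [->|->] := sgnP b => /= e1 e2.
  have AE : A = 1.
    apply: (mulIf s); transitivity ((A * phi + B) - (A * (1 - phi) + B));
      first by ring.
    by rewrite -e1 -e2; ring.
  by split=> //; move: e1; rewrite AE mul1r => e1;
    rewrite -[B](addKr phi) -e1 addNr.
have AE : A = -1.
  apply: (mulIf s); transitivity ((A * phi + B) - (A * (1 - phi) + B));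
    first by ring.
  by rewrite -e1 -e2; ring.
split; first by rewrite AE.
by move: e1; rewrite AE mulN1r => e1; rewrite -[B](addKr (- phi)) -e1; ring.
Qed.

Lemma luc_modp : (luc p)%:~R = 1 :> K.
Proof.
have hP : [pchar K].-nat p by rewrite -[p]expn1 pchar_pnat_expn.
by rewrite (luc_golden _ phi2) exprDn_pchar // exprNn_pchar // expr1n addrC subrK.
Qed.

End Golden.

Lemma poly_trace_golden (phi : algC) (f : {poly int}) : phi ^+ 2 = phi + 1 ->
  exists N : int, (map_poly intr f).[phi] + (map_poly intr f).[1 - phi] = N%:~R.
Proof.
move=> phi2; exists (\sum_(i < size (map_poly (intr : int -> algC) f)) f`_i *
  luc i).
rewrite !horner_coef -big_split rmorph_sum /=; apply: eq_bigr => i _.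
by rewrite coef_map /= rmorphM /= (luc_golden _ phi2) mulrDr.
Qed.

(** [phi ^ (p ^ b)] is [phi] or its conjugate up to a multiple of [p], so its [p]-th power is known
    up to a multiple of [p ^ 2]; adding conjugates gives the Lucas numbers. *)
Lemma luc_prime_power p b : prime p -> p <> 5%N ->
  exists N : int, luc (p ^ b.+1) = luc p + p%:Z ^+ 2 * N.
Proof.
move=> p_prime p5.
have [K charK] := ex_closed_field_pchar p_prime.
have [w [w2 wF]] := ex_golden_frobenius charK p5.
have P0 : (0 < p ^ b)%N by rewrite expn_gt0 prime_gt0.
have [f1 f2] := fib_prime_power charK p5 w2 wF (prednK P0).
have mE := prednK P0; set m := (p ^ b).-1 in f1 f2 mE.
set eps := sgn5 (p ^ b) in f1 f2.
have [al alE] : exists c, (fib m.+1)%:Z - eps = p%:Z * c.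
  by apply: (@intr_pchar_eq0 K) => //; rewrite rmorphB /= -pmulrn f1 subrr.
have [be beE] : exists c, (fib m)%:Z - (eps != 1)%:Z = p%:Z * c.
  by apply: (@intr_pchar_eq0 K) => //; rewrite rmorphB /= -!pmulrn f2 subrr.
(* Working with integer polynomials gives one remainder for both conjugates, so that the trace of
   that remainder is an integer. *)
have [Z ZE] := @exprDp_mod_sqr {poly int} p (eps%:P * 'X + (eps != 1)%:Z%:P)
  (al%:P * 'X + be%:P) (prime_gt0 p_prime).
have [phi phi2] := ex_golden_algC.
have [N NE] := poly_trace_golden Z phi2; exists N.
have psi2 : (1 - phi) ^+ 2 = (1 - phi) + 1.
  by transitivity (phi ^+ 2 - phi - phi + 1); [|rewrite phi2]; ring.
have F1 : (fib m.+1)%:R = eps%:~R + p%:R * al%:~R :> algC.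
  have := congr1 (fun i : int => i%:~R : algC) alE.
  by rewrite -[_ - _]/(_ + _) rmorphB rmorphM -[LHS]/(_%:~R - _%:~R) -!pmulrn
    => <-; rewrite addrC subrK.
have F2 : (fib m)%:R = (eps != 1)%:~R + p%:R * be%:~R :> algC.
  have := congr1 (fun i : int => i%:~R : algC) beE.
  by rewrite /= rmorphB rmorphM /= -!pmulrn => <-; rewrite addrC subrK.
have ev (x : algC) : x ^+ 2 = x + 1 -> x ^+ (p ^ b.+1)
    = (if eps == 1 then x else 1 - x) ^+ p + p%:R ^+ 2 * (map_poly intr Z).[x].
  move=> x2; rewrite expnSr exprM -mE (fib_golden m x2) F1 F2.
  transitivity ((eps%:~R * x + (eps != 1)%:~R) ^+ p + p%:R ^+ 2 * (map_poly
    intr Z).[x]).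
    have := congr1 (fun f : {poly int} =>
      (map_poly (intr : int -> algC) f).[x]) ZE.
    rewrite /= -!polyC_natr !(rmorphD, rmorphM, rmorphXn) /= !map_polyC /=
      map_polyX !hornerE.
    rewrite !rmorph_nat -expr2 => <-; congr (_ ^+ p); rewrite -?pmulrn /=; ring.
  congr (_ ^+ p + _); rewrite /eps;
    have [->|->] := sgn5_sign (prime_power_not_dvd5 b p_prime p5) => /=; ring.
have trE (A : int) : (A + p%:Z ^+ 2 * N)%:~R = A%:~R + p%:R ^+ 2 * N%:~R :> algC.
  by rewrite intrD intrM expr2 intrM -!pmulrn -expr2.
apply: (@intr_inj algC); rewrite trE -NE.
rewrite !(luc_golden _ phi2) (ev _ phi2) (ev _ psi2).
by case: ifP => _; rewrite ?subKr; ring.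
Qed.

(** * The two congruences *)

Ltac pintegral_tac :=
  lazymatch goal with
  | |- is_true (_%:R \in _) => apply: rpred_nat
  | |- is_true (_%:~R \in _) => apply: rpred_int
  | |- is_true (- _ \in _) => rewrite rpredN; pintegral_tac
  | |- is_true (_ ^+ _ \in _) => apply: rpredX; pintegral_tac
  | |- is_true (_ + _ \in _) => apply: rpredD; pintegral_tac
  | |- is_true (_ * _ \in _) => apply: rpredM; pintegral_tac
  | |- _ => assumption
  end.

Lemma central_sum_m32 p a : prime p -> odd p -> (0 < a)%N -> p <> 3%N ->
  ratcong p 3 (central_sum ((p ^ a - 1) %/ 2) (-32 : rat))
    ((jacobi 2 (p ^ a))%:~R
     * (1 + (2 ^+ (p ^ a - 1) - 1) / 6 - (2 ^+ (p ^ a - 1) - 1) ^+ 2 / 8)).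
Proof.
move=> p_prime p_odd a_gt0 p3.
have [K charK] := ex_closed_field_pchar p_prime.
rewrite jacobi_prime_power //; case: a a_gt0 => // b _.
have q_odd : odd (p ^ b.+1) by rewrite oddX p_odd orbT.
have nE := half_oddK q_odd; set n := ((p ^ b.+1 - 1) %/ 2)%N in nE *.
have -> : (p ^ b.+1 - 1 = n * 2)%N by lia.
clearbody n.
have dV : (-32)^-1 \in pintegral p.
  by rewrite invrN rpredN (pintegral_natV (@coprime_odd_exp2 p 5 p_odd)).
have dp : -32 \in pintegral p by rewrite rpredN rpred_nat.
have pc3 : coprime p 3 by rewrite prime_coprime // dvdn_prime2 //; apply/eqP.
have V24 : 24%:R^-1 \in pintegral p.
  apply: pintegral_natV => //; rewrite (_ : 24 = 3 * 2 ^ 3)%N // coprimeMr pc3.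
  exact: coprime_odd_exp2.
have [v vE] : exists v, 2 ^+ p - 2 = p%:Z * v.
  apply: (@intr_pchar_eq0 K) => //; rewrite rmorphB rmorphXn /=.
  by have := natr_modpX 1 2 charK; rewrite expn1 => ->; rewrite subrr.
have [z2 zE] : exists z, 2 ^+ (p ^ b) - 2 = p%:Z * z.
  apply: (@intr_pchar_eq0 K) => //; rewrite rmorphB rmorphXn /=.
  by have := natr_modpX b 2 charK => ->; rewrite subrr.
have [m mE] : exists m, 2 ^+ (p ^ b.+1) = 2 ^+ p + p%:Z ^+ 2 * m.
  have [w e] := exprDp_mod_sqr (2 : int) z2 (prime_gt0 p_prime); exists w.
  by rewrite (natz p) -zE addrC subrK in e; rewrite expnSr exprM e.
have eC := central_sum_m32_corr charK p_odd p3 nE vE.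
have : 2 ^+ n = (legendre 2 p ^+ b.+1)%:~R :> K.
  by rewrite rmorphXn; apply: exp2_legendre.
have : (legendre 2 p ^+ b.+1 = 1) \/ (legendre 2 p ^+ b.+1 = -1).
  case: (@legendre_sign 2 p) => [|->|->].
  - by rewrite dvdzE absz_nat gtnNdvd // odd_prime_gt2.
  - by left; rewrite expr1n.
  - by rewrite -signr_odd; case: (odd _); [right|left].
move: (legendre 2 p ^+ b.+1) eC => eps eC epsE e2.
have eps2 : eps ^+ 2 = 1 by case: epsE => ->.
have [e eE] : exists e, eps * 2 ^+ n - 1 = p%:Z * e.
  apply: (@intr_pchar_eq0 K) => //; rewrite rmorphB rmorphM rmorphXn /= e2.
  by rewrite -rmorphM /= -expr2 eps2 subrr.
(* Passage from the Fermat quotient at [p] to [e], using [2 ^ q = 2 (1 + p e) ^ 2]. *)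
have vE2 : v = 4 * e + p%:Z * (2 * e ^+ 2 - m).
  have p0 : p%:Z != 0 by rewrite eqz_nat -lt0n prime_gt0.
  apply: (mulfI p0); rewrite -vE.
  have -> : 2 ^+ p = 2 ^+ (p ^ b.+1) - p%:Z ^+ 2 * m by rewrite mE addrK.
  rewrite -nE exprS mulnC exprM.
  have -> : (2 ^+ n) ^+ 2 = (1 + p%:Z * e) ^+ 2.
    by rewrite -eE addrC subrK exprMn eps2 mul1r.
  ring.
have pC : central_corr (p ^ b) n (-32) \in pintegral p.
  exact: (central_corr_pintegral charK nE dV erefl).
have [y py yE] : exists2 y, y \in pintegral p &
    24 * central_corr (p ^ b) n (-32) + (eps * v ^+ 2)%:~R = p%:R * y.
  apply: (ratr_eq0_p charK); first by
    rewrite rpredD ?rpredM ?rpred_nat ?rpred_int.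
  rewrite (ratrD_p charK) ?rpredM ?rpred_nat ?rpred_int //.
  by rewrite (ratrM_p charK) ?rpred_nat // ratr_nat ratr_int eC addNr.
have [z pz ->] := central_sum_expansion p_prime nE dV.
have tx : 2 * (-16 / -32) = (2 - 1) ^+ 2 :> rat by field.
have : 2 ^+ n * (1 + 2) * chebU n (-16 / -32) = 1 + 2 * (2 ^+ n) ^+ 2 :> rat.
  by rewrite (chebUE n tx) [2 ^+ (2 * n).+1]exprS mulnC exprM.
have sV : (2 ^+ n)^-1 \in pintegral p.
  rewrite -natrX; apply: pintegral_natV; first exact: coprime_odd_exp2.
  by rewrite expn_eq0.
have s0 : 2 ^+ n != 0 :> rat by rewrite expf_neq0.
have sE : eps%:~R * 2 ^+ n = 1 + p%:R * e%:~R :> rat.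
  have := congr1 (fun i : int => i%:~R : rat) eE.
  by rewrite /= rmorphB !rmorphM rmorphXn /= -pmulrn => <-; rewrite addrC subrK.
rewrite (_ : (2 ^+ (n * 2) : rat) = (2 ^+ n) ^+ 2); last by rewrite exprM.
move: (2 ^+ n) (chebU n _) (central_corr _ _ _) s0 sE sV yE =>
  s U C s0 sE sV yE eU.
set t := p%:R in sE yE *.
set e' : rat := e%:~R in sE.
have sE' : s = eps%:~R * (1 + t * e').
  by rewrite -sE mulrA -rmorphM /= -expr2 eps2 mul1r.
have eps0 : eps%:~R != 0 :> rat by rewrite intr_eq0; case: epsE => ->.
have nz : 1 + t * e' != 0.
  by rewrite -sE; exact: mulf_neq0 eps0 s0.
have tV : (1 + t * e')^-1 \in pintegral p.
  have -> : (1 + t * e')^-1 = eps%:~R * s^-1.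
    by rewrite -sE invfM; case: epsE => ->; rewrite ?invrN invr1.
  exact: rpredM (rpred_int _ _) sV.
have vE' : v%:~R = 4 * e' + t * (2 * e ^+ 2 - m)%:~R :> rat.
  by rewrite vE2 rmorphD !rmorphM.
have CE : C = (t * y - eps%:~R * v%:~R ^+ 2) / 24.
  by rewrite -yE rmorphM rmorphXn /=; field.
have UE : U = (1 + 2 * s ^+ 2) / (3 * s) by apply: (mulfI s0); rewrite -eU; field.
pose m' : rat := (2 * e ^+ 2 - m)%:~R.
(* With [u = t * e'], the leading term exceeds the target by [2 u ^ 2 / 3] up to the factor [eps],
   and [- 16 u ^ 2 / 24] from the correction cancels it. The witness collects the cubic remainder of
   the quotient by [1 + u], the rest of the correction, and the expansion error. *)
apply: (@ratcongP _ _ _ _ (eps%:~R * e' ^+ 3 * (4 + 15 * (t * e') + 3 * (t *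
  e') ^+ 2)
     * (1 + t * e')^-1 / 24 + (y - eps%:~R * (8 * e' * m' + t * m' ^+ 2)) / 24
       + t * z)).
- have pe : e' \in pintegral p by rewrite rpred_int.
  have pt : t \in pintegral p by rewrite rpred_nat.
  have pm : m' \in pintegral p by rewrite rpred_int.
  have pep : eps%:~R \in pintegral p by rewrite rpred_int.
  move: (1 + t * e')^-1 (24%:R^-1) tV V24 pe pt pm pep => i h pi ph pe pt pm pep.
  by pintegral_tac.
- by rewrite -lt0n prime_gt0.
rewrite UE CE vE' -/m' sE'.
by case: epsE => ->; field; rewrite ?nz //.
Qed.

(** Here [t = phi ^ 2] and [x = 1]. Multiplying by [phi] turns [t ^ n] into [phi ^ p], which is
    [phi] or [1 - phi] according to [sgn5 p]. *)
Lemma golden_sum_odd_harm2 (K : closedFieldType) p n (l : int) :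
  p \in [pchar K] -> (2 * n).+1 = p -> p <> 5%N -> luc p - 1 = p%:Z * l ->
  10 * \sum_(0 <= k < n.+1) 'C(2 * k, k)%:R / (-16) ^+ k * odd_harm2 K k
  = - (sgn5 p * l ^+ 2)%:~R :> K.
Proof.
move=> charK nE p5 lE; have p_prime := pcharf_prime charK.
have [p3|p_gt3] := leqP p 3.
  have pE : p = 3%N by have := prime_gt1 p_prime; lia.
  have -> : n = 1%N by lia.
  have -> : l = 1 by move: lE; rewrite pE (_ : luc 3 = 4) //; lia.
  have K3 : 3 = 0 :> K by rewrite -pE (pcharf0 charK).
  rewrite big_nat_recr //= big_nat1 /odd_harm2 big_geq // big_nat1 pE mulr0 add0r.
  rewrite (_ : sgn5 3 = -1) // (_ : (-16) ^+ 1 = -1 :> K); last first.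
    by transitivity (-1 - 5 * 3 : K); [ring|rewrite K3 mulr0 subr0].
  have -> : - (-1 * 1 ^+ 2)%:~R = 1 :> K by rewrite expr1n mulr1 rmorphN1 opprK.
  rewrite (_ : 'C(2 * 1, 1) = 2)%N // muln0.
  transitivity (1 - 7 * 3 : K); last by rewrite K3 mulr0 subr0.
  by field; rewrite oppr_eq0 oner_eq0.
have [phi [phi2 phiF]] := ex_golden_frobenius charK p5.
have tx : phi ^+ 2 * 1 = (phi ^+ 2 - 1) ^+ 2.
  by rewrite {2}phi2 addrK mulr1.
have := central_sum_odd_harm2 (esym nE) charK p_gt3 tx.
rewrite (eq_bigr (fun k => 'C(2 * k, k)%:R / (-16) ^+ k * odd_harm2 K k));
  last first.
  by move=> k _; rewrite expr1n mulr1.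
move: (\sum_(0 <= k < n.+1) _) => C eC.
have eD := fpolylog2_golden (esym nE) charK p_gt3 phi2.
rewrite (fpolylog1_golden (esym nE) charK phi2 lE) sqrrN in eD.
have two0 : 2 != 0 :> K by apply: (natr_neq0_pchar charK); lia.
have s := sqrt5_neq0 charK p5 phi2.
have e : 10 * (phi ^+ p * (1 + phi ^+ 2)) * C = - phi * (phi ^+ p + 2) * l%:~R
  ^+ 2.
  transitivity (10 * phi * ((phi ^+ 2) ^+ n * (1 + phi ^+ 2) * C)).
    by rewrite -{1}nE exprS -exprM; ring.
  rewrite eC; transitivity (phi * (5 * fpolylog p 2 (phi ^+ 2))); first by field.
  by rewrite eD; ring.
have phi0 : phi != 0.
  apply/eqP => e0; move: phi2; rewrite e0 expr0n add0r /= => /eqP.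
  by rewrite eq_sym oner_eq0.
rewrite rmorphM rmorphXn /=; have := phiF 1%N; rewrite expn1 => fE.
rewrite {}fE in e.
have [s5|s5] := @sgn5_sign p (@prime_power_not_dvd5 p 1 p_prime p5);
  rewrite s5 /= in e *.
  have nz : phi * (2 + phi) != 0.
    (* Modulo [phi ^ 2 - phi - 1] the factor is [phi ^ 2] times the square root [2 phi - 1] of [5],
       hence nonzero. *)
    have -> : phi * (2 + phi)
        = phi ^+ 2 * (2 * phi - 1) - 2 * phi * (phi ^+ 2 - (phi + 1)) by ring.
    by rewrite [X in _ - _ * (X - _)]phi2 subrr mulr0 subr0 mulf_neq0 //
      expf_neq0.
  apply: (mulfI nz); rewrite mul1r.
  transitivity (10 * (phi * (1 + phi ^+ 2)) * C); first by rewrite phi2; ring.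
  by rewrite e; ring.
apply: (mulfI s); rewrite mulN1r opprK.
transitivity (- (10 * ((1 - phi) * (1 + phi ^+ 2)) * C) - 10 * (phi ^+ 2 - (phi
  + 1)) * C * phi).
  by ring.
rewrite e [X in _ * (X - _) * C]phi2 subrr mulr0 !mul0r subr0.
transitivity ((2 * phi - 1) * l%:~R ^+ 2 - (phi ^+ 2 - (phi + 1)) * l%:~R ^+
  2); first by ring.
by rewrite phi2 subrr mul0r subr0.
Qed.

Lemma central_sum_m16_corr (K : closedFieldType) p b n (l : int) :
  p \in [pchar K] -> odd p -> p <> 5%N -> (2 * n).+1 = (p ^ b.+1)%N ->
  luc p - 1 = p%:Z * l ->
  10 * ratr (central_corr (p ^ b) n (-16))
  = - (sgn5 (p ^ b.+1) * l ^+ 2)%:~R :> K.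
Proof.
move=> charK p_odd p5 nE lE; have p_prime := pcharf_prime charK.
have dp : -16 \in pintegral p by rewrite rpredN rpred_nat.
have dV : (-16)^-1 \in pintegral p.
  by rewrite invrN rpredN (pintegral_natV (@coprime_odd_exp2 p 4 p_odd)).
have n1E := half_oddK p_odd; set n1 := ((p - 1) %/ 2)%N in n1E.
have pb_odd : odd (p ^ b) by rewrite oddX p_odd orbT.
have nbE := half_oddK pb_odd; set nb := ((p ^ b - 1) %/ 2)%N in nbE.
clearbody n1 nb.
have d16 : ratr (-16) = -16 :> K by exact: (ratr_int K (-16)).
have nz16 : -16 != 0 :> K.
  have two0 : 2 != 0 :> K.
    by apply: (natr_neq0_pchar charK); have := odd_prime_gt2 p_odd p_prime; lia.
  by rewrite oppr_eq0 (natrM K 4 4) (natrM K 2 2) !mulf_neq0.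
rewrite (ratr_central_corr charK nE n1E nbE dp dV).
rewrite (central_sum_chebU charK nbE dp dV) d16 divff // chebU1.
have [phi [phi2 phiF]] := ex_golden_frobenius charK p5.
have [-> _] := fib_prime_power charK p5 phi2 phiF nbE.
rewrite mulrCA (golden_sum_odd_harm2 charK n1E p5 lE) mulrN -rmorphM /=.
by rewrite expnS sgn5M; congr (- _%:~R); ring.
Qed.

Lemma cassini m :
  (fib m.+1)%:Z ^+ 2 - (fib m.+1)%:Z * (fib m)%:Z - (fib m)%:Z ^+ 2 = (-1) ^+ m.
Proof.
elim: m => [//|m IH]; rewrite [(-1) ^+ m.+1]exprS -IH fibSS PoszD.
by move: (fib m.+1)%:Z (fib m)%:Z => A B; ring.
Qed.

(** Twisting by the sign makes Cassini's identity and the Lucas number the same expressions in [f]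
    and [G] for both values of [sgn5 q], so the final computation needs no case distinction. *)
Lemma fib_jacobi_index q n : (2 * n).+1 = q -> ~~ (5 %| q)%N ->
  let G : int := (fib (absz (q%:Z - sgn5 q)%R))%:Z in
  let f := sgn5 q * (fib q)%:Z in
  f ^+ 2 - f * G - G ^+ 2 = 1 /\ luc q = f + 2 * G.
Proof.
move=> qE q5 /=.
have := cassini (2 * n); rewrite qE exprM sqrrN expr1n.
rewrite /luc; have [->|->] := sgn5_sign q5.
  have -> : absz (q%:Z - 1)%R = (2 * n)%N by lia.
  rewrite -[in fib q.+1]qE fibSS qE PoszD mul1r.
  by move: (fib q)%:Z (fib (2 * n))%:Z => A B h; split; [rewrite -[RHS]h|]; ring.
have -> : absz (q%:Z - (-1))%R = q.+1 by lia.
rewrite -[in fib q.+1]qE fibSS qE PoszD.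
by move: (fib q)%:Z (fib (2 * n))%:Z => A B h; split; [rewrite -[RHS]h|]; ring.
Qed.

(* With [f = e * F = 1 + G / 2 + r], the quadratic relation reads
   [(1 + r) ^+ 2 = 1 + 5 / 4 * G ^+ 2], which pins down [r] modulo [p ^+ 4]. *)
Lemma golden_remainder p (F G e l f N y z : rat) :
  p != 0%N -> 2%:R^-1 \in pintegral p -> 4%:R^-1 \in pintegral p -> 10%:R^-1
    \in pintegral p ->
  y \in pintegral p -> z \in pintegral p ->
  e ^+ 2 = 1 -> F = e * (1 + p%:R * f) ->
  (e * F) ^+ 2 - e * F * G - G ^+ 2 = 1 ->
  e * F + 2 * G = 1 + p%:R * l + p%:R ^+ 2 * N ->
  e \in pintegral p -> p%:R \in pintegral p -> l \in pintegral p ->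
  f \in pintegral p -> N \in pintegral p ->
  ratcong p 3 (F + p%:R ^+ 2 * ((p%:R * y - e * l ^+ 2) / 10) + p%:R ^+ 4 * z)
    (e * (1 + G / 2)).
Proof.
move=> p0 V2 V4 V10 yp zp e2 FE fG lq ep tp lp fp Np.
have t0 : p%:R != 0 :> rat by rewrite pnatr_eq0.
have eF : e * F = 1 + p%:R * f by rewrite FE mulrA -expr2 e2 mul1r.
rewrite eF in fG lq.
have [g gE] : exists g, g = (l + p%:R * N - f) * 2^-1 by eexists.
have GE : G = p%:R * g.
  have -> : G = ((1 + p%:R * f + 2 * G) - (1 + p%:R * f)) / 2 by field.
  by rewrite lq gE; field.
have gp : g \in pintegral p by rewrite gE; pintegral_tac.
have [r1 r1E] : exists r1, r1 = f - g * 2^-1 by eexists.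
have [r2 r2E] : exists r2, r2 = (5 * g ^+ 2 * 4^-1 - r1 ^+ 2) * 2^-1 by eexists.
have r1p : r1 \in pintegral p by rewrite r1E; pintegral_tac.
have r2p : r2 \in pintegral p by rewrite r2E; pintegral_tac.
have rE : p%:R * r1 = p%:R ^+ 2 * r2.
  have -> : p%:R * r1 = ((1 + p%:R * f) ^+ 2 - (1 + p%:R * f) * G - G ^+ 2 - 1
      + 5 * G ^+ 2 / 4 - (p%:R * r1) ^+ 2) / 2.
    by rewrite r1E GE; field.
  by rewrite fG r2E GE; field.
have fr1 : p%:R * f = p%:R * r1 + p%:R * g / 2 by rewrite r1E; field.
(* Only [l] modulo [p] matters: [l = 5 g / 2] turns [- p ^ 2 l ^ 2 / 10] into [- 5 p ^ 2 g ^ 2 / 8],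
   which cancels the quadratic part of the remainder. *)
have [k kE] : exists k, k = r2 - N by eexists.
have lE : l = 5 * g / 2 + p%:R * k.
  apply: (mulfI t0).
  have -> : p%:R * l = (1 + p%:R * f + 2 * G) - 1 - p%:R ^+ 2 * N by
    rewrite lq; ring.
  by rewrite fr1 rE GE kE; field.
have fE : p%:R * f = p%:R * g / 2 + 5 * p%:R ^+ 2 * g ^+ 2 / 8 - p%:R ^+ 4 * r2
  ^+ 2 / 2.
  have -> : p%:R ^+ 4 * r2 ^+ 2 = (p%:R * r1) ^+ 2 by rewrite rE; ring.
  by rewrite fr1 {1}rE r2E; field.
apply: (@ratcongP _ _ _ _ (- (e * (p%:R * r2 ^+ 2) * 2^-1)
   + (y - e * (5 * g * k + p%:R * k ^+ 2)) * 10^-1 + p%:R * z)) => //.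
  have kp : k \in pintegral p by rewrite kE; pintegral_tac.
  by pintegral_tac.
by rewrite FE fE lE GE; field.
Qed.

Lemma central_sum_m16 p a : prime p -> odd p -> (0 < a)%N -> p <> 5%N ->
  ratcong p 3 (central_sum ((p ^ a - 1) %/ 2) (-16 : rat))
    ((jacobi (p ^ a)%N%:Z 5)%:~R
      * (1 + (fib (absz ((p ^ a)%N%:Z - jacobi (p ^ a)%N%:Z 5)%R))%:R / 2)).
Proof.
move=> p_prime p_odd a_gt0 p5.
have [K charK] := ex_closed_field_pchar p_prime.
rewrite jacobi5; case: a a_gt0 => // b _.
have q_odd : odd (p ^ b.+1) by rewrite oddX p_odd orbT.
have nE := half_oddK q_odd; set n := ((p ^ b.+1 - 1) %/ 2)%N in nE *.
clearbody n.
have dV : (-16)^-1 \in pintegral p.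
  by rewrite invrN rpredN (pintegral_natV (@coprime_odd_exp2 p 4 p_odd)).
have V2 : 2%:R^-1 \in pintegral p.
  exact: (pintegral_natV (@coprime_odd_exp2 p 1 p_odd)).
have V4 : 4%:R^-1 \in pintegral p.
  exact: (pintegral_natV (@coprime_odd_exp2 p 2 p_odd)).
have V10 : 10%:R^-1 \in pintegral p.
  apply: pintegral_natV => //; rewrite (_ : 10 = 5 * 2 ^ 1)%N // coprimeMr.
  rewrite coprime_odd_exp2 // andbT prime_coprime // dvdn_prime2 //.
  exact/eqP.
have [phi [phi2 phiF]] := ex_golden_frobenius charK p5.
have [l lE] : exists l, luc p - 1 = p%:Z * l.
  by apply: (@intr_pchar_eq0 K) => //;
    rewrite rmorphB /= (luc_modp charK phi2) subrr.
have [N NE] := luc_prime_power b p_prime p5.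
have eC := central_sum_m16_corr charK p_odd p5 nE lE.
have q5 := prime_power_not_dvd5 b.+1 p_prime p5.
have [fG lq] := fib_jacobi_index nE q5.
have [fq _] := fib_prime_power charK p5 phi2 phiF nE.
have pC : central_corr (p ^ b) n (-16) \in pintegral p.
  exact: (central_corr_pintegral charK nE dV erefl).
have [z pz ->] := central_sum_expansion p_prime nE dV.
rewrite divff // chebU1 nE [(fib (p ^ b.+1))%:R]pmulrn; rewrite nE pmulrn in fq.
move: (sgn5_sign q5) fG lq fq eC => epsE.
move: (absz _) => i; move: (sgn5 _) epsE => eps epsE.
rewrite [(fib i)%:R]pmulrn.
move: (fib i)%:Z (fib _)%:Z (central_corr _ _ _) pC => G F C pC fG lq fq eC.
have eps2 : eps ^+ 2 = 1 by case: epsE => ->.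
have [f' f'E] : exists c, eps * F - 1 = p%:Z * c.
  apply: (@intr_pchar_eq0 K) => //; rewrite rmorphB rmorphM /= fq.
  by rewrite -rmorphM /= -expr2 eps2 subrr.
have [y py yE] : exists2 y, y \in pintegral p &
    10 * C + (eps * l ^+ 2)%:~R = p%:R * y.
  have p10 : 10 * C \in pintegral p by exact: rpredM (rpred_nat _ _) pC.
  apply: (ratr_eq0_p charK); first exact: rpredD p10 (rpred_int _ _).
  rewrite (ratrD_p charK p10 (rpred_int _ _)) (ratrM_p charK (rpred_nat _ _) pC).
  by rewrite ratr_nat ratr_int eC addNr.
have e2 : eps%:~R ^+ 2 = 1 :> rat by case: epsE => ->.
have FE : F%:~R = eps%:~R * (1 + p%:R * f'%:~R) :> rat.
  have -> : F = eps * (1 + p%:Z * f').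
    by rewrite -f'E addrC subrK mulrA -expr2 eps2 mul1r.
  by rewrite intrM intrD intrM -pmulrn.
have fG' : (eps%:~R * F%:~R) ^+ 2 - (eps%:~R * F%:~R) * G%:~R - G%:~R ^+ 2 = 1
  :> rat.
  have := congr1 (fun i : int => i%:~R : rat) fG.
  by rewrite /= !(rmorphB, rmorphM, rmorphXn).
have lq' : eps%:~R * F%:~R + 2 * G%:~R = 1 + p%:R * l%:~R + p%:R ^+ 2 * N%:~R
  :> rat.
  have h : eps * F + 2 * G = 1 + p%:Z * l + p%:Z ^+ 2 * N.
    by rewrite -lq NE -lE; ring.
  have := congr1 (fun i : int => i%:~R : rat) h.
  by rewrite /= !(intrD, intrM) -!pmulrn -expr2.
have epsp : eps%:~R \in pintegral p by apply: rpred_int.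
have tp : p%:R \in pintegral p by apply: rpred_nat.
have lp : l%:~R \in pintegral p by apply: rpred_int.
have fp : f'%:~R \in pintegral p by apply: rpred_int.
have Np : N%:~R \in pintegral p by apply: rpred_int.
have yE' : C = (p%:R * y - eps%:~R * l%:~R ^+ 2) / 10.
  by rewrite -yE intrM expr2 intrM -expr2; field.
rewrite {}yE'; move: e2 FE fG' lq' epsp tp lp fp Np.
have p0 : p != 0%N by rewrite -lt0n prime_gt0.
move: (F%:~R) (G%:~R) (eps%:~R) (l%:~R) (f'%:~R) (N%:~R) => Fr Gr e lr f Nr.
exact: golden_remainder.
Qed.

(* absz below only converts an int to a nat: for p odd and a > 0 the index
   p ^ a - (p ^ a / 5) is at least 2. *)
Theorem theorem1p1 (p a : nat) (p_prime : prime p) (p_odd : odd p)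
    (a_gt0 : (0 < a)%N) :
  (p <> 5%N ->
   ratcong p 3
     (\sum_(0 <= k < ((p ^ a - 1) %/ 2).+1) ('C(2 * k, k))%:R / (-16) ^+ k)
     ((jacobi (p ^ a)%N%:Z 5)%:~R
      * (1 + (fib (absz ((p ^ a)%N%:Z - jacobi (p ^ a)%N%:Z 5)%R))%:R / 2)))
  /\
  (p <> 3%N ->
   ratcong p 3
     (\sum_(0 <= k < ((p ^ a - 1) %/ 2).+1) ('C(2 * k, k))%:R / (-32) ^+ k)
     ((jacobi 2 (p ^ a)%N)%:~R
      * (1 + (2 ^+ (p ^ a - 1) - 1) / 6 - (2 ^+ (p ^ a - 1) - 1) ^+ 2 / 8))).
Proof. by split; [exact: central_sum_m16 | exact: central_sum_m32]. Qed.
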